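(* Let $n\ge 2$ be an integer, $k,c_b>0$, $\rho_0>0$, and let $\lambda_{1,0},\dots,\lambda_{n,0}$ be real numbers with $\lambda_{1,0}=\cdots=\lambda_{J,0}<\lambda_{J+1,0}\le\cdots\le\lambda_{n,0}$ for some integer $1\le J\le n$. Consider the system $$\lambda_i'=-\lambda_i^2+\frac{k}{n}(\rho-c_b)\ (i=1,\dots,n),\qquad \rho'=-\rho\lambda,\quad \lambda=\sum_{i=1}^n\lambda_i,\qquad \rho(0)=\rho_0,\ \lambda_i(0)=\lambda_{i,0},$$ suppose its maximal interval of existence is $[0,t_B)$ with $0<t_B<\infty$, let $u_i(t)=e^{\int_0^t\lambda_i(s)\,ds}$, and let $p,q$ be the real numbers with $\lim_{t\to t_B^-}u_1'(t)u_n(t)=-p$ and $\lim_{t\to t_B^-}u_1(t)u_n'(t)=q$. Suppose $p>q$ and set $\xi_1=\frac{-p}{p-q}$, $\xi_n=\frac{q}{p-q}$. Then there are functions $R_i$ on $[0,t_B)$ with $\lim_{t\to t_B^-}(t_B-t)R_i(t)=0$ ($1\le i\le n$), $R_i=R_1$ for $1\le i\le J$, such that $$\lambda_i(t)=\frac{\xi_1}{t_B-t}+R_i(t)\ (1\le i\le J),\qquad \lambda_i(t)=\frac{\xi_n}{t_B-t}+R_i(t)\ (J<i\le n),$$ and hence $\lambda(t)=\frac{\gamma}{t_B-t}+R(t)$ with $\gamma=\frac{-pJ+q(n-J)}{p-q}$ and $R=\sum_{i=1}^nR_i$. Moreover one of the following holds, where $\xi$ ranges over $\{\xi_1,\xi_n\}$: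 (1) $J=1$ and $\xi^2+\xi=0$; (2-a) $J=2$, $\lim_{t\to t_B^-}\int_0^tR(s)\,ds=\infty$, and $\xi^2+\xi=0$; (2-b) $J=2$, $n=4$, $\lim_{t\to t_B^-}e^{-\int_0^tR(s)\,ds}=R_0>0$, and $\xi^2+\xi-\frac{k\rho_0t_B^2R_0}{4}=0$; (3) $J\ge3$, $n>2J$, $\lim_{t\to t_B^-}e^{-\int_0^tR(s)\,ds}=R_0>0$, and $\xi^2+\xi-\frac{k\rho_0t_B^2R_0}{n}=0$. Furthermore: in case (1), $\lim_{t\to t_B^-}(t_B-t)\lambda_1(t)=-1$, $\lambda_i(t)=\mathcal O(|\ln(t_B-t)|)$ for $2\le i\le n$, and $\rho(t)=\mathcal O(\frac1{t_B-t})$ as $t\to t_B^-$; in case (2-a), $n\ge5$, $\lim_{t\to t_B^-}(t_B-t)\lambda_1(t)=-1$, and for $3\le i\le n$, $\lim_{t\to t_B^-}(t_B-t)\lambda_i(t)=0$ and $\lim_{t\to t_B^-}\int_0^t\lambda_i(s)\,ds=\infty$, and $\rho(t)=o(\frac1{(t_B-t)^2})$; in case (2-b), $A_0:=(\lambda_{1,0}-\lambda_{3,0})(\lambda_{1,0}-\lambda_{4,0})>k\rho_0$, $\lim_{t\to t_B^-}(t_B-t)\lambda_1(t)=-\frac12-\frac12\sqrt{\frac{A_0}{A_0-k\rho_0}}$, $\lim_{t\to t_B^-}(t_B-t)\lambda_i(t)=-\frac12+\frac12\sqrt{\frac{A_0}{A_0-k\rho_0}}$ for $i=3,4$, and $\rho(t)=\mathcal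 O(\frac1{(t_B-t)^2})$; in case (3), there is $C>1$ with $\lim_{t\to t_B^-}(t_B-t)\lambda_1(t)=-C$, $\lim_{t\to t_B^-}(t_B-t)\lambda_i(t)=C-1$ for $J+1\le i\le n$, and $\rho(t)=\mathcal O(\frac1{(t_B-t)^2})$ (all as $t\to t_B^-$).
   Context: Solutions are real-valued and continuously differentiable on $[0,t_B)$. It is known (and may be assumed) that the limits defining $p$ and $q$ exist with $0\le q\le p$. $f=\mathcal O(g)$ as $x\to x_0^-$ means $|f(x)|\le M|g(x)|$ for some $M,\delta>0$ and all $0<x_0-x<\delta$; $f=o(g)$ means for every $\varepsilon>0$ there is $\delta>0$ with $|f(x)|\le\varepsilon|g(x)|$ for $0<x_0-x<\delta$. *)

(* Defs.v *)
From Stdlib Require Import Reals Lra Lia.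
From Coquelicot Require Import Coquelicot.
Open Scope R_scope.

(* Indices run over 1..n (index 0 and indices > n are ignored). *)

Definition is_sol (n : nat) (k cb rho0 : R) (lam0 : nat -> R) (T : R)
    (lam : nat -> R -> R) (rho : R -> R) : Prop :=
  rho 0 = rho0 /\
  (forall i, (1 <= i <= n)%nat -> lam i 0 = lam0 i) /\
  filterlim rho (at_right 0) (locally rho0) /\
  (forall i, (1 <= i <= n)%nat -> filterlim (lam i) (at_right 0) (locally (lam0 i))) /\
  (forall t, 0 < t < T ->
     is_derive rho t (- rho t * sum_n_m (fun i => lam i t) 1 n) /\
     (forall i, (1 <= i <= n)%nat ->
        is_derive (lam i) t (- (lam i t) ^ 2 + k / INR n * (rho t - cb)))).

Definition is_maximal_sol (n : nat) (k cb rho0 : R) (lam0 : nat -> R) (tB : R)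
    (lam : nat -> R -> R) (rho : R -> R) : Prop :=
  is_sol n k cb rho0 lam0 tB lam rho /\
  forall (T : R) (lam' : nat -> R -> R) (rho' : R -> R), tB < T ->
    is_sol n k cb rho0 lam0 T lam' rho' ->
    ~ (forall t, 0 <= t < tB ->
         rho' t = rho t /\ (forall i, (1 <= i <= n)%nat -> lam' i t = lam i t)).

Definition bigO_left (x0 : R) (f g : R -> R) : Prop :=
  exists M delta, 0 < M /\ 0 < delta /\
    forall t, 0 < x0 - t < delta -> Rabs (f t) <= M * Rabs (g t).

Definition littleo_left (x0 : R) (f g : R -> R) : Prop :=
  forall eps, 0 < eps -> exists delta, 0 < delta /\
    forall t, 0 < x0 - t < delta -> Rabs (f t) <= eps * Rabs (g t).

Definition lim_left (f : R -> R) (x0 l : R) : Prop :=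
  filterlim f (at_left x0) (locally l).

Definition lim_left_pinfty (f : R -> R) (x0 : R) : Prop :=
  filterlim f (at_left x0) (Rbar_locally p_infty).

(* Main.v *)
(* All [u_i] solve the same linear equation [u'' = (k/n)(rho - cb) u], so the Wronskians of pairs
   are constant and [rho = rho0 / (u_1 ... u_n)].  The product [u_1 u_n] has derivative tending to
   [q - p < 0]; were its limit at [tB] positive, every [lambda_i] and [rho] would converge and
   the solution could be continued by a power series.  Hence [u_1 u_n ~ (p - q) s] with
   [s = tB - t], which yields [s lambda_1 -> xi_1] and [s lambda_i -> xi_n] for [i > J].

   The cases are separated by [theta = (k/n) s^2 rho] and [mu = s lambda_1], which satisfy
   [s mu' = - mu - mu^2 + theta + o(1)] and [s theta' / theta -> - 2 - gamma].  As [mu] converges,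
   [theta] cannot blow up, so [gamma >= - 2].  If [gamma > - 2] then [theta -> 0], [q = 0] and
   [J = 1].  If [gamma = - 2] then [theta] varies slowly, so it converges to
   [xi^2 + xi = p q / (p - q)^2].  For [q = 0], [gamma = - 2] gives [J = 2], and
   [theta ~ c u_n^(4 - n)] must vanish, which rules out [n <= 4]. *)
Require Import Defs.
From Stdlib Require Import Arith Reals Lra Lia.
From Coquelicot Require Import Coquelicot.
Open Scope R_scope.

(** * Left limits and the mean value theorem *)

(** Slow variation alone does not make theta converge: s theta' / theta -> 0 still allows growth
    like ln (1/s) or endless oscillation. The equation for mu supplies what is missing: during a
    time comparable to s, theta changes only by a factor close to 1 while the convergent mu moves by
    o(1), so theta must be close to xi_1^2 + xi_1 throughout. The exponents satisfy xi_1 + xi_n =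
    -1, so they are the two roots of one quadratic. Clearing denominators in gamma = -2 leaves p (J
    - 2) = q (n - J - 2), which decides the relation between J and n when q > 0. For q = 0 the
    delicate exclusion is n = 3, which needs u_n to stay away from zero. Power series suit the
    continuation because the right-hand side is a quadratic polynomial: a geometric bound on the
    Taylor coefficients reproduces itself by induction. *)

Lemma at_left_iff (b : R) (P : R -> Prop) :
  at_left b P <-> exists a, a < b /\ forall t, a < t < b -> P t.
Proof.
  split.
  - intros [e He]. exists (b - e). split; [destruct e; simpl; lra|].
    intros t Ht. apply He; [|lra].
    change (Rabs (t - b) < e). apply Rabs_def1; lra.
  - intros [a [Hab Ha]]. assert (He : 0 < b - a) by lra.
    exists (mkposreal _ He). intros t Ht Htb. apply Ha.
    change (Rabs (t - b) < b - a) in Ht. apply Rabs_def2 in Ht. lra.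
Qed.

Lemma at_left_and (b : R) (P Q : R -> Prop) :
  at_left b P -> at_left b Q -> at_left b (fun t => P t /\ Q t).
Proof. apply filter_and. Qed.
Arguments at_left_and {b P Q}.

Lemma at_left_ex {b : R} {P : R -> Prop} : at_left b P -> exists t, P t.
Proof. apply (filter_ex (F := at_left b)). Qed.

Lemma at_left_gt (a b : R) : a < b -> at_left b (fun t => a < t < b).
Proof. intros H. apply at_left_iff. exists a. auto. Qed.

Lemma lim_left_iff (f : R -> R) (b l : R) :
  lim_left f b l <-> forall eps, 0 < eps -> at_left b (fun t => Rabs (f t - l) < eps).
Proof.
  unfold lim_left. rewrite filterlim_locally. split.
  - intros H eps Heps. exact (H (mkposreal _ Heps)).
  - intros H eps. exact (H eps (cond_pos eps)).
Qed.

Lemma lim_left_ext (f g : R -> R) (b l : R) :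
  at_left b (fun t => f t = g t) -> lim_left f b l -> lim_left g b l.
Proof. intros H. apply filterlim_ext_loc. exact H. Qed.

Lemma lim_left_comp (g f : R -> R) (b l : R) :
  continuous g l -> lim_left f b l -> lim_left (fun t => g (f t)) b (g l).
Proof. intros Hg Hf. exact (filterlim_comp _ _ _ f g _ _ _ Hf Hg). Qed.

Lemma lim_left_plus (f g : R -> R) (b l m : R) :
  lim_left f b l -> lim_left g b m -> lim_left (fun t => f t + g t) b (l + m).
Proof. intros Hf Hg. exact (filterlim_comp_2 f g Rplus Hf Hg (filterlim_plus l m)). Qed.

Lemma lim_left_mult (f g : R -> R) (b l m : R) :
  lim_left f b l -> lim_left g b m -> lim_left (fun t => f t * g t) b (l * m).
Proof. intros Hf Hg. exact (filterlim_comp_2 f g Rmult Hf Hg (filterlim_mult l m)). Qed.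

Lemma lim_left_const (b c : R) : lim_left (fun _ => c) b c.
Proof. apply filterlim_const. Qed.

Lemma lim_left_opp (f : R -> R) (b l : R) :
  lim_left f b l -> lim_left (fun t => - f t) b (- l).
Proof. intros Hf. exact (filterlim_comp _ _ _ f Ropp _ _ _ Hf (filterlim_opp l)). Qed.

Lemma lim_left_minus (f g : R -> R) (b l m : R) :
  lim_left f b l -> lim_left g b m -> lim_left (fun t => f t - g t) b (l - m).
Proof. intros Hf Hg. apply lim_left_plus; [exact Hf|apply lim_left_opp, Hg]. Qed.

Lemma lim_left_div (f g : R -> R) (b l m : R) :
  m <> 0 -> lim_left f b l -> lim_left g b m -> lim_left (fun t => f t / g t) b (l / m).
Proof.
  intros Hm Hf Hg. apply lim_left_mult; [exact Hf|].
  apply (lim_left_comp Rinv); [|exact Hg].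
  apply (ex_derive_continuous Rinv m). auto_derive. exact Hm.
Qed.

Lemma lim_left_unique (f : R -> R) (b l m : R) :
  lim_left f b l -> lim_left f b m -> l = m.
Proof. intros Hl Hm. exact (filterlim_locally_unique (F := at_left b) f l m Hl Hm). Qed.

Lemma lim_left_id (b : R) : lim_left (fun t => t) b b.
Proof.
  apply lim_left_iff. intros eps Heps. apply at_left_iff. exists (b - eps).
  split; [lra|]. intros t Ht. apply Rabs_def1; lra.
Qed.

Lemma lim_left_remaining (b : R) : lim_left (fun t => b - t) b 0.
Proof.
  rewrite <- (Rminus_diag b).
  apply lim_left_minus; [apply lim_left_const|apply lim_left_id].
Qed.

Lemma lim_left_gt (f : R -> R) (b l m : R) :
  lim_left f b l -> m < l -> at_left b (fun t => m < f t).
Proof.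
  intros Hf Hm. assert (H : 0 < l - m) by lra.
  apply lim_left_iff with (eps := l - m) in Hf; [|exact H].
  revert Hf. apply filter_imp. intros t Ht. apply Rabs_def2 in Ht. lra.
Qed.

Lemma lim_left_lt (f : R -> R) (b l m : R) :
  lim_left f b l -> l < m -> at_left b (fun t => f t < m).
Proof.
  intros Hf Hm. assert (H : 0 < m - l) by lra.
  apply lim_left_iff with (eps := m - l) in Hf; [|exact H].
  revert Hf. apply filter_imp. intros t Ht. apply Rabs_def2 in Ht. lra.
Qed.

Lemma lim_left_ge_bound (f : R -> R) (b l m : R) :
  lim_left f b l -> at_left b (fun t => m <= f t) -> m <= l.
Proof.
  intros Hf Hm. apply Rnot_lt_le. intros Hl.
  destruct (at_left_ex (at_left_and Hm (lim_left_lt _ _ _ _ Hf Hl))) as [t Ht]. lra.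
Qed.

Lemma lim_left_le_bound (f : R -> R) (b l m : R) :
  lim_left f b l -> at_left b (fun t => f t <= m) -> l <= m.
Proof.
  intros Hf Hm. apply Rnot_lt_le. intros Hl.
  destruct (at_left_ex (at_left_and Hm (lim_left_gt _ _ _ _ Hf Hl))) as [t Ht]. lra.
Qed.

Lemma lim_left_squeeze (f g h : R -> R) (b l : R) :
  at_left b (fun t => f t <= g t <= h t) ->
  lim_left f b l -> lim_left h b l -> lim_left g b l.
Proof.
  intros Hfgh Hf Hh. apply lim_left_iff. intros eps Heps.
  generalize (at_left_and Hfgh (at_left_and
    (lim_left_gt _ _ _ (l - eps) Hf ltac:(lra)) (lim_left_lt _ _ _ (l + eps) Hh ltac:(lra)))).
  apply filter_imp. intros t Ht. apply Rabs_def1; lra.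
Qed.

Lemma lim_left_pinfty_iff (f : R -> R) (b : R) :
  lim_left_pinfty f b <-> forall M, at_left b (fun t => M < f t).
Proof.
  split.
  - intros H M. apply (H (fun y => M < y)). exists M. auto.
  - intros H P [M HM]. change (at_left b (fun t => P (f t))).
    generalize (H M). apply filter_imp. intros t Ht. apply HM, Ht.
Qed.

Lemma lim_left_pinfty_not_finite (f : R -> R) (b l : R) :
  lim_left_pinfty f b -> lim_left f b l -> False.
Proof.
  intros Hi Hf.
  destruct (at_left_ex (at_left_and (proj1 (lim_left_pinfty_iff _ _) Hi (l + 1))
    (lim_left_lt _ _ _ (l + 1) Hf ltac:(lra)))) as [t Ht]. lra.
Qed.

Lemma lim_left_pinfty_ge (f g : R -> R) (b C : R) :
  at_left b (fun t => g t + C <= f t) -> lim_left_pinfty g b -> lim_left_pinfty f b.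
Proof.
  rewrite !lim_left_pinfty_iff. intros H Hg M.
  generalize (at_left_and H (Hg (M - C))). apply filter_imp. intros t Ht. lra.
Qed.

Lemma lim_left_exp_opp_pinfty (f : R -> R) (b : R) :
  lim_left_pinfty f b -> lim_left (fun t => exp (- f t)) b 0.
Proof.
  intros H. apply lim_left_iff. intros eps Heps.
  generalize (proj1 (lim_left_pinfty_iff _ _) H (- ln eps)). apply filter_imp.
  intros t Ht. rewrite Rminus_0_r, Rabs_pos_eq by (left; apply exp_pos).
  rewrite <- (exp_ln eps) by exact Heps. apply exp_increasing. lra.
Qed.

Lemma lim_left_pinfty_of_exp_opp (f : R -> R) (b : R) :
  lim_left (fun t => exp (- f t)) b 0 -> lim_left_pinfty f b.
Proof.
  intros H. apply lim_left_pinfty_iff. intros M.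
  generalize (lim_left_lt _ _ _ (exp (- M)) H (exp_pos _)). apply filter_imp.
  intros t Ht. apply exp_lt_inv in Ht. lra.
Qed.

Lemma exp_le (x y : R) : x <= y -> exp x <= exp y.
Proof.
  intros [H| ->]; [left; apply exp_increasing, H|apply Rle_refl].
Qed.

Lemma is_derive_continuity_pt (f : R -> R) (x l : R) : is_derive f x l -> continuity_pt f x.
Proof.
  intros H. apply continuity_pt_filterlim.
  exact (ex_derive_continuous f x (ex_intro _ l H)).
Qed.

(** * Mean value estimates near an endpoint *)

Lemma mvt_derive (f df : R -> R) (a b : R) :
  a <= b -> (forall x, a <= x <= b -> is_derive f x (df x)) ->
  exists c, a <= c <= b /\ f b - f a = df c * (b - a).
Proof.
  intros Hab Hd.
  destruct (MVT_gen f a b df) as [c Hc].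
  - intros x Hx. rewrite Rmin_left, Rmax_right in Hx by exact Hab. apply Hd. lra.
  - intros x Hx. rewrite Rmin_left, Rmax_right in Hx by exact Hab.
    exact (is_derive_continuity_pt _ _ _ (Hd x Hx)).
  - rewrite Rmin_left, Rmax_right in Hc by exact Hab. exists c. exact Hc.
Qed.

Lemma derive_nonneg_le (f df : R -> R) (a b : R) :
  a <= b -> (forall x, a <= x <= b -> is_derive f x (df x)) ->
  (forall x, a <= x <= b -> 0 <= df x) -> f a <= f b.
Proof.
  intros Hab Hd Hp. destruct (mvt_derive f df a b Hab Hd) as [c [Hc Heq]].
  pose proof (Rmult_le_pos _ (b - a) (Hp c Hc) ltac:(lra)). lra.
Qed.

(** A bounded derivative makes [f] Lipschitz near [b], hence Cauchy there; this yields a limit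
    without naming it in advance. *)
Lemma derive_bounded_lim_left (f df : R -> R) (b M : R) :
  at_left b (fun t => is_derive f t (df t)) ->
  at_left b (fun t => Rabs (df t) <= M) ->
  exists l, lim_left f b l.
Proof.
  intros Hd Hb.
  apply (proj1 (filterlim_locally_cauchy (F := at_left b) f)). intros eps.
  destruct (proj1 (at_left_iff _ _) (at_left_and Hd Hb)) as [a [Hab Ha]].
  assert (HM : 0 <= M).
  { destruct (Ha ((a + b) / 2)) as [_ H]; [lra|]. pose proof (Rabs_pos (df ((a + b) / 2))). lra. }
  assert (Hlip : forall u v, a < u -> u <= v -> v < b -> Rabs (f v - f u) <= M * (v - u)).
  { intros u v Hu Huv Hv.
    destruct (mvt_derive f df u v Huv) as [c [Hc ->]].
    - intros x Hx. apply Ha. lra.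
    - rewrite Rabs_mult, (Rabs_pos_eq (v - u)) by lra.
      apply Rmult_le_compat_r; [lra|]. apply Ha. lra. }
  pose proof (cond_pos eps) as He.
  (* Dividing by [M + 1] rather than [M] covers [M = 0]. *)
  assert (Hde : 0 < eps / (M + 1)) by (apply Rdiv_lt_0_compat; lra).
  exists (fun t => Rmax a (b - eps / (M + 1)) < t < b). split.
  { apply at_left_gt. apply Rmax_lub_lt; lra. }
  assert (Hsmall : forall u v, Rmax a (b - eps / (M + 1)) < u -> u <= v -> v < b ->
     Rabs (f v - f u) < eps).
  { intros u v Hu Huv Hv.
    pose proof (Rmax_l a (b - eps / (M + 1))). pose proof (Rmax_r a (b - eps / (M + 1))).
    eapply Rle_lt_trans; [apply Hlip; lra|].
    apply Rle_lt_trans with ((M + 1) * (v - u)); [nra|].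
    replace (pos eps) with ((M + 1) * (eps / (M + 1))) by (field; lra).
    apply Rmult_lt_compat_l; lra. }
  intros u v [Hu1 Hu2] [Hv1 Hv2].
  change (Rabs (f v - f u) < eps).
  destruct (Rle_dec u v).
  - apply Hsmall; assumption.
  - rewrite Rabs_minus_sym. apply Hsmall; lra.
Qed.

(** L'Hopital's rule with denominator [b - t]; the sign appears because this denominator
    decreases. *)
Lemma derive_lim_left_quotient (f df : R -> R) (b d : R) :
  at_left b (fun t => is_derive f t (df t)) ->
  lim_left f b 0 -> lim_left df b d ->
  lim_left (fun t => f t / (b - t)) b (- d).
Proof.
  intros Hd Hf Hdf. apply lim_left_iff. intros eps Heps.
  assert (He2 : 0 < eps / 2) by lra.
  destruct (proj1 (at_left_iff _ _) (at_left_and Hd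
    (proj1 (lim_left_iff _ _ _) Hdf (eps / 2) He2))) as [a [Hab Ha]].
  apply at_left_iff. exists a. split; [exact Hab|]. intros t Ht.
  (* The mean value estimate on [t, v] with v < b passes to the limit v -> b, so the value of [f] at
     [b] is irrelevant. *)
  assert (Hbnd : Rabs (f t + d * (b - t)) <= (eps / 2) * (b - t)).
  { assert (HL : lim_left (fun v => Rabs (f v - f t - d * (v - t))) b
                   (Rabs (0 - f t - d * (b - t)))).
    { apply (lim_left_comp Rabs); [apply continuous_Rabs|].
      apply lim_left_minus.
      - apply lim_left_minus; [exact Hf|apply lim_left_const].
      - apply lim_left_mult; [apply lim_left_const|].
        apply lim_left_minus; [apply lim_left_id|apply lim_left_const]. }
    replace (Rabs (f t + d * (b - t))) with (Rabs (0 - f t - d * (b - t)))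
      by (rewrite <- Rabs_Ropp; f_equal; ring).
    apply (lim_left_le_bound _ _ _ _ HL). apply at_left_iff. exists t. split; [lra|].
    intros v Hv. destruct (mvt_derive f df t v) as [c [Hc ->]]; [lra| |].
    - intros x Hx. apply Ha. lra.
    - destruct (Ha c) as [_ Hcd]; [lra|].
      replace (df c * (v - t) - d * (v - t)) with ((df c - d) * (v - t)) by ring.
      rewrite Rabs_mult, (Rabs_pos_eq (v - t)) by lra.
      pose proof (Rabs_pos (df c - d)). apply Rmult_le_compat; lra. }
  replace (f t / (b - t) - - d) with ((f t + d * (b - t)) / (b - t)) by (field; lra).
  unfold Rdiv. rewrite Rabs_mult, (Rabs_pos_eq (/ _)).
  2: left; apply Rinv_0_lt_compat; lra.
  apply Rle_lt_trans with ((eps / 2) * (b - t) * / (b - t)).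
  - apply Rmult_le_compat_r; [left; apply Rinv_0_lt_compat; lra|exact Hbnd].
  - rewrite Rmult_assoc, Rinv_r by lra. lra.
Qed.

(** Comparison with [- kappa * ln (b - t)], whose derivative is [kappa / (b - t)]. *)
Lemma log_derivative_pinfty (g h : R -> R) (b kappa : R) :
  0 < kappa ->
  at_left b (fun t => is_derive g t (h t)) ->
  at_left b (fun t => kappa <= (b - t) * h t) ->
  lim_left_pinfty g b.
Proof.
  intros Hk Hd Hh.
  destruct (proj1 (at_left_iff _ _) (at_left_and Hd Hh)) as [a [Hab Ha]].
  set (t0 := (a + b) / 2).
  assert (Ht0 : a < t0 < b) by (unfold t0; lra).
  apply lim_left_pinfty_iff. intros M.
  set (C := g t0 + kappa * ln (b - t0)).
  assert (Hg : forall t, t0 <= t < b -> C - kappa * ln (b - t) <= g t).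
  { intros t Ht.
    assert (g t0 + kappa * ln (b - t0) <= g t + kappa * ln (b - t)).
    { apply (derive_nonneg_le (fun t => g t + kappa * ln (b - t))
        (fun t => h t - kappa / (b - t))); [lra| |].
      - intros x Hx. destruct (Ha x) as [Hdx _]; [lra|].
        auto_derive.
        + repeat split; [exists (h x); exact Hdx|lra].
        + replace (Derive _ x) with (h x) by (symmetry; apply is_derive_unique, Hdx).
          field. lra.
      - intros x Hx. destruct (Ha x) as [_ Hx2]; [lra|].
        apply Rmult_le_reg_l with (b - x); [lra|].
        replace ((b - x) * (h x - kappa / (b - x))) with ((b - x) * h x - kappa) by (field; lra).
        lra. }
    unfold C. lra. }
  (* At this distance from [b] the lower bound [C - kappa * ln (b - t)] equals [M + 1]. *)
  apply at_left_iff. exists (Rmax t0 (b - exp ((C - M - 1) / kappa))).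
  pose proof (exp_pos ((C - M - 1) / kappa)).
  split; [apply Rmax_lub_lt; lra|]. intros t Ht.
  pose proof (Rmax_l t0 (b - exp ((C - M - 1) / kappa))).
  pose proof (Rmax_r t0 (b - exp ((C - M - 1) / kappa))).
  assert (Hln : ln (b - t) < (C - M - 1) / kappa).
  { rewrite <- (ln_exp ((C - M - 1) / kappa)). apply ln_increasing; lra. }
  apply Rlt_le_trans with (C - kappa * ln (b - t)); [|apply Hg; lra].
  apply (Rmult_lt_compat_l kappa) in Hln; [|exact Hk].
  replace (kappa * ((C - M - 1) / kappa)) with (C - M - 1) in Hln by (field; lra). lra.
Qed.

(** A nonzero [kappa] would drive [g] or [- g] to infinity at least logarithmically. *)
Lemma log_derivative_lim_zero (g h : R -> R) (b l kappa : R) :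
  at_left b (fun t => is_derive g t (h t)) ->
  lim_left g b l ->
  lim_left (fun t => (b - t) * h t) b kappa ->
  kappa = 0.
Proof.
  intros Hd Hg Hh.
  assert (Hgen : forall (g h : R -> R) (l kappa : R),
    at_left b (fun t => is_derive g t (h t)) -> lim_left g b l ->
    lim_left (fun t => (b - t) * h t) b kappa -> 0 < kappa -> False).
  { clear. intros g h l kappa Hd Hg Hh Hk.
    apply (lim_left_pinfty_not_finite g b l); [|exact Hg].
    apply (log_derivative_pinfty g h b (kappa / 2)); [lra|exact Hd|].
    generalize (lim_left_gt _ _ _ (kappa / 2) Hh ltac:(lra)).
    apply filter_imp. intros; lra. }
  destruct (Rtotal_order kappa 0) as [H|[H|H]]; [exfalso|exact H|exfalso].
  - apply (Hgen (fun t => - g t) (fun t => - h t) (- l) (- kappa)).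
    + revert Hd. apply filter_imp. intros t Ht. exact (is_derive_opp g t _ Ht).
    + apply lim_left_opp, Hg.
    + apply lim_left_ext with (fun t => - ((b - t) * h t)).
      * apply filter_forall. intros; ring.
      * apply lim_left_opp, Hh.
    + lra.
  - exact (Hgen g h l kappa Hd Hg Hh H).
Qed.

(* On [t, (t+b)/2] the mean value theorem for [mu] produces a point where [exp psi + e] is
   small, and [psi] varies by [o(1)] on such an interval. *)
Lemma slowly_varying_tauberian (mu psi eta e : R -> R) (b xi E : R) :
  lim_left mu b xi ->
  lim_left e b (- E) ->
  lim_left eta b 0 ->
  at_left b (fun t => is_derive mu t ((exp (psi t) + e t) / (b - t))) ->
  at_left b (fun t => is_derive psi t (eta t / (b - t))) ->
  lim_left (fun t => exp (psi t)) b E.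
Proof.
  intros Hmu He Heta Hdmu Hdpsi. apply lim_left_iff. intros eps Heps.
  (* The value at [t] is exp (psi c) times exp (psi t - psi c) for a good point c; joint continuity
     at (E, 0) controls both factors at once. *)
  assert (Hcont : filterlim (fun z : R * R => fst z * exp (snd z))
     (filter_prod (locally E) (locally 0)) (locally (E * exp 0))).
  { apply (filterlim_comp_2 fst (fun z => exp (snd z)) Rmult (G := locally E) (H := locally (exp 0))).
    - apply filterlim_fst.
    - apply (filterlim_comp _ _ _ snd exp _ (locally 0)); [apply filterlim_snd|].
      apply (ex_derive_continuous exp 0). auto_derive. exact I.
    - apply (filterlim_mult E (exp 0)). }
  rewrite exp_0, Rmult_1_r in Hcont.
  destruct (Hcont _ (locally_ball E (mkposreal _ Heps))) as [Q S HQ HS HQS].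
  destruct HQ as [d1 Hd1]. destruct HS as [d2 Hd2].
  (* With tolerance d1/8 at both ends [mu] moves by less than d1/4, which the factor 2 (b - c) / (b
     - t) at most doubles; [e] uses the other d1/2. *)
  assert (Hp1 : 0 < d1 / 8) by (pose proof (cond_pos d1); lra).
  assert (Hp2 : 0 < d1 / 2) by lra.
  destruct (proj1 (at_left_iff _ _)
    (at_left_and (at_left_and Hdmu Hdpsi)
     (at_left_and (proj1 (lim_left_iff _ _ _) Hmu _ Hp1)
     (at_left_and (proj1 (lim_left_iff _ _ _) He _ Hp2)
       (proj1 (lim_left_iff _ _ _) Heta _ (cond_pos d2)))))) as [a [Hab Ha]].
  apply at_left_iff. exists a. split; [exact Hab|]. intros t Ht.
  (* Halving the remaining time keeps it comparable to b - t on the whole interval, so [psi] varies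
     there by at most a value of |eta|. *)
  set (t1 := (t + b) / 2).
  destruct (mvt_derive mu (fun t => (exp (psi t) + e t) / (b - t)) t t1) as [c [Hc Hceq]].
  { unfold t1; lra. }
  { intros x Hx. apply Ha. unfold t1 in Hx; lra. }
  destruct (mvt_derive psi (fun t => eta t / (b - t)) t c) as [d [Hd Hdeq]].
  { lra. }
  { intros x Hx. apply Ha. unfold t1 in *; lra. }
  assert (Hy : Rabs (exp (psi c) - E) < d1).
  { destruct (Ha t Ht) as [_ [Hmt _]].
    destruct (Ha t1) as [_ [Hmt1 _]]; [unfold t1; lra|].
    destruct (Ha c) as [_ [_ [Hec _]]]; [unfold t1 in *; lra|].
    assert (Hr : exp (psi c) + e c = (mu t1 - mu t) * (2 * (b - c) / (b - t))).
    { rewrite Hceq. unfold t1. field. unfold t1 in *. lra. }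
    assert (Hr1 : 0 <= 2 * (b - c) / (b - t) <= 2).
    { split.
      - apply Rmult_le_pos; [unfold t1 in *; lra|left; apply Rinv_0_lt_compat; lra].
      - apply Rmult_le_reg_r with (b - t); [lra|].
        unfold Rdiv. rewrite Rmult_assoc, Rinv_l by lra. lra. }
    assert (Hmm : Rabs (mu t1 - mu t) < d1 / 4).
    { apply Rabs_def2 in Hmt. apply Rabs_def2 in Hmt1. apply Rabs_def1; lra. }
    assert (Hprod : Rabs (exp (psi c) + e c) <= d1 / 4 * 2).
    { rewrite Hr, Rabs_mult, (Rabs_pos_eq (2 * _ / _)) by lra.
      apply Rmult_le_compat; [apply Rabs_pos|lra|lra|lra]. }
    apply Rabs_def2 in Hec. apply Rabs_le_between in Hprod. apply Rabs_def1; lra. }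
  assert (Hz : Rabs (psi t - psi c) < d2).
  { destruct (Ha d) as [_ [_ [_ Hed]]]; [unfold t1 in *; lra|].
    rewrite Rminus_0_r in Hed.
    rewrite Rabs_minus_sym, Hdeq.
    replace (eta d / (b - d) * (c - t)) with (eta d * ((c - t) / (b - d)))
      by (field; unfold t1 in *; lra).
    assert (Hr1 : 0 <= (c - t) / (b - d) <= 1).
    { split.
      - apply Rmult_le_pos; [lra|left; apply Rinv_0_lt_compat; unfold t1 in *; lra].
      - apply Rmult_le_reg_r with (b - d); [unfold t1 in *; lra|].
        unfold Rdiv. rewrite Rmult_assoc, Rinv_l; unfold t1 in *; lra. }
    rewrite Rabs_mult, (Rabs_pos_eq (_ / _)) by lra.
    pose proof (Rabs_pos (eta d)). nra. }
  replace (psi t) with (psi c + (psi t - psi c)) by ring. rewrite exp_plus.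
  apply (HQS (exp (psi c)) (psi t - psi c)).
  - apply Hd1. exact Hy.
  - apply Hd2. change (Rabs (psi t - psi c - 0) < d2). rewrite Rminus_0_r. exact Hz.
Qed.

(** * Continuation of bounded solutions *)

Lemma sum_1_S (a : nat -> R) (m : nat) :
  sum_n_m a 1 (S m) = sum_n_m a 1 m + a (S m).
Proof. apply (sum_n_Sm a 1 m). lia. Qed.

Lemma sum_1_0 (a : nat -> R) : sum_n_m a 1 0 = 0.
Proof. apply (sum_n_m_zero a 1 0). lia. Qed.

Lemma sum_1_Rabs_le (a : nat -> R) (B : R) (m : nat) :
  (forall i, (1 <= i <= m)%nat -> Rabs (a i) <= B) -> Rabs (sum_n_m a 1 m) <= INR m * B.
Proof.
  induction m as [|m IH]; intros H.
  - rewrite sum_1_0, Rabs_R0. simpl. lra.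
  - rewrite sum_1_S, S_INR. eapply Rle_trans; [apply Rabs_triang|].
    specialize (IH ltac:(intros; apply H; lia)). specialize (H (S m) ltac:(lia)). lra.
Qed.

(** The factor m + 1 counts the terms of the Cauchy product; the division in the Taylor recursion
    will absorb it. *)
Lemma PS_mult_bound (a b : nat -> R) (A B K : R) (m : nat) :
  (forall j, (j <= m)%nat -> Rabs (a j) <= A * K ^ j) ->
  (forall j, (j <= m)%nat -> Rabs (b j) <= B * K ^ j) ->
  Rabs (PS_mult a b m) <= INR (S m) * (A * B * K ^ m).
Proof.
  intros Ha Hb. unfold PS_mult.
  eapply Rle_trans; [apply sum_f_R0_triangle|].
  rewrite Rmult_comm, <- sum_cte. apply sum_Rle. intros j Hj.
  rewrite Rabs_mult.
  replace (A * B * K ^ m) with ((A * K ^ j) * (B * K ^ (m - j))).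
  - apply Rmult_le_compat; try apply Rabs_pos; [apply Ha|apply Hb]; lia.
  - replace (K ^ m) with (K ^ j * K ^ (m - j)); [ring|].
    rewrite <- pow_add. f_equal. lia.
Qed.

Lemma CV_radius_gt_of_geometric (a : nat -> R) (M K x : R) :
  0 < K -> (forall j, Rabs (a j) <= M * K ^ j) -> Rabs x < / K ->
  Rbar_lt (Rabs x) (CV_radius a).
Proof.
  intros HK Ha Hx. apply Rbar_lt_le_trans with (/ K); [exact Hx|].
  apply (CV_radius_bounded a). exists M. intros j.
  assert (HKj : 0 < K ^ j) by (apply pow_lt, HK).
  rewrite Rabs_mult, pow_inv, (Rabs_pos_eq (/ _)) by (left; apply Rinv_0_lt_compat, HKj).
  apply Rmult_le_reg_r with (K ^ j); [exact HKj|].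
  rewrite Rmult_assoc, Rinv_l by lra. rewrite Rmult_1_r. apply Ha.
Qed.

Lemma is_pseries_sum (c : nat -> nat -> R) (x : R) (l : nat -> R) (m : nat) :
  (1 <= m)%nat ->
  (forall i, (1 <= i <= m)%nat -> is_pseries (c i) x (l i)) ->
  is_pseries (fun j => sum_n_m (fun i => c i j) 1 m) x (sum_n_m l 1 m).
Proof.
  induction m as [|m IH]; intros Hm H; [lia|].
  destruct (Nat.eq_dec m 0) as [->|Hm0].
  - rewrite sum_n_n. apply is_pseries_ext with (c 1%nat).
    + intros j. rewrite sum_n_n. reflexivity.
    + apply H. lia.
  - rewrite sum_1_S.
    apply is_pseries_ext with (PS_plus (fun j => sum_n_m (fun i => c i j) 1 m) (c (S m))).
    + intros j. rewrite sum_1_S. reflexivity.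
    + apply (is_pseries_plus _ _ x (sum_n_m l 1 m) (l (S m))).
      * apply IH; [lia|]. intros; apply H; lia.
      * apply H. lia.
Qed.

(* Index [0] stands for [rho - cb] (this shift makes the system homogeneous), index
   [i >= 1] for [lambda_i]. *)
Definition system_coef (n : nat) (kn cb : R) (c : nat -> nat -> R) (i m : nat) : R :=
  match i with
  | O => - PS_mult (c O) (fun j => sum_n_m (fun l => c l j) 1 n) m
         - cb * sum_n_m (fun l => c l m) 1 n
  | S _ => - PS_mult (c i) (c i) m + kn * c O m
  end.

(** Coefficient m + 1 of one component depends on all lower coefficients of several components. The
    recursion therefore builds whole tables, and table [m] is final up to order [m]. *)
Fixpoint taylor_approx (n : nat) (kn cb : R) (x0 : nat -> R) (m i j : nat) : R :=
  match m with
  | O => match j with O => x0 i | S _ => 0 end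
  | S m' => if Nat.eq_dec j m
            then system_coef n kn cb (taylor_approx n kn cb x0 m') i m' / INR m
            else taylor_approx n kn cb x0 m' i j
  end.

Definition taylor_coef (n : nat) (kn cb : R) (x0 : nat -> R) (i m : nat) : R :=
  taylor_approx n kn cb x0 m i m.

Lemma taylor_approx_stable n kn cb x0 m i j :
  (j <= m)%nat -> taylor_approx n kn cb x0 m i j = taylor_coef n kn cb x0 i j.
Proof.
  unfold taylor_coef. induction m as [|m IH]; intros Hj.
  - replace j with 0%nat by lia. reflexivity.
  - destruct (Nat.eq_dec j (S m)) as [->|Hne]; [reflexivity|].
    simpl. destruct (Nat.eq_dec j (S m)); [contradiction|]. apply IH. lia.
Qed.

(** Order [m] of the right-hand side sees only orders up to [m], so a finite table may be exchanged
    for the final coefficients. *)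
Lemma system_coef_local n kn cb c d i m :
  (forall l j, (j <= m)%nat -> c l j = d l j) ->
  system_coef n kn cb c i m = system_coef n kn cb d i m.
Proof.
  intros H.
  assert (Hs : forall j, (j <= m)%nat ->
    sum_n_m (fun l => c l j) 1 n = sum_n_m (fun l => d l j) 1 n).
  { intros j Hj. apply sum_n_m_ext. intros l. apply H, Hj. }
  destruct i as [|i]; unfold system_coef, PS_mult.
  - rewrite Hs by lia. f_equal. f_equal. apply sum_eq. intros j Hj.
    rewrite H, Hs by lia. reflexivity.
  - rewrite (H O) by lia. f_equal. f_equal. apply sum_eq. intros j Hj.
    rewrite !H by lia. reflexivity.
Qed.

(** The differential system, read coefficient by coefficient. *)
Lemma PS_derive_taylor_coef n kn cb x0 i m :
  PS_derive (taylor_coef n kn cb x0 i) m = system_coef n kn cb (taylor_coef n kn cb x0) i m.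
Proof.
  unfold PS_derive, taylor_coef at 1. cbn [taylor_approx].
  destruct (Nat.eq_dec (S m) (S m)) as [_|H]; [|contradiction].
  rewrite (system_coef_local n kn cb _ (taylor_coef n kn cb x0) i m).
  - field. apply not_0_INR. lia.
  - intros l j Hj. apply taylor_approx_stable, Hj.
Qed.

(** Strong induction on the order: a product of series costs a factor m + 1, the recursion divides
    by m + 1, so one ratio [K] serves all orders. *)
Lemma taylor_coef_geometric n kn cb x0 :
  exists M K, 0 < K /\ 0 < M /\ forall j i, (i <= n)%nat ->
    Rabs (taylor_coef n kn cb x0 i j) <= M * K ^ j.
Proof.
  assert (HM : exists M, 0 < M /\ forall i, (i <= n)%nat -> Rabs (x0 i) <= M).
  { induction n as [|n' [M [HM IH]]].
    - exists (Rabs (x0 O) + 1). split; [pose proof (Rabs_pos (x0 O)); lra|].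
      intros i Hi. replace i with O by lia. lra.
    - exists (M + Rabs (x0 (S n'))). pose proof (Rabs_pos (x0 (S n'))). split; [lra|].
      intros i Hi. destruct (Nat.eq_dec i (S n')) as [->|]; [lra|].
      specialize (IH i ltac:(lia)). lra. }
  destruct HM as [M [HM Hx0]].
  set (N := INR n). assert (HN : 0 <= N) by apply pos_INR.
  pose proof (Rabs_pos cb) as Hcb. pose proof (Rabs_pos kn) as Hkn.
  (* [K] dominates the factor N M + |cb| N of the equation with index 0 and the factor M + |kn| of
     the others. *)
  set (K := N * M + Rabs cb * N + M + Rabs kn + 1).
  assert (HK : 0 < K).
  { unfold K. pose proof (Rmult_le_pos N M HN ltac:(lra)).
    pose proof (Rmult_le_pos _ N Hcb HN). lra. }
  exists M, K. split; [exact HK|]. split; [exact HM|].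
  set (c := taylor_coef n kn cb x0).
  induction j as [j IH] using Wf_nat.lt_wf_ind. intros i Hi.
  destruct j as [|m]; [simpl; rewrite Rmult_1_r; apply Hx0, Hi|].
  assert (IHm : forall l j, (l <= n)%nat -> (j <= m)%nat -> Rabs (c l j) <= M * K ^ j).
  { intros l j Hl Hj. apply IH; lia. }
  assert (HKm : 0 < K ^ m) by (apply pow_lt, HK).
  assert (HS : 1 <= INR (S m)) by (rewrite S_INR; pose proof (pos_INR m); lra).
  assert (Hsum : forall j, (j <= m)%nat ->
    Rabs (sum_n_m (fun l => c l j) 1 n) <= N * M * K ^ j).
  { intros j Hj. rewrite Rmult_assoc. apply sum_1_Rabs_le. intros l Hl. apply IHm; lia. }
  set (D := M * K ^ m). assert (HD : 0 < D) by (apply Rmult_lt_0_compat; assumption).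
  assert (Hb : Rabs (system_coef n kn cb c i m) <= INR (S m) * (D * K)).
  { destruct i as [|i]; unfold system_coef.
    - pose proof (PS_mult_bound (c O) (fun j => sum_n_m (fun l => c l j) 1 n) M (N * M) K m
        ltac:(intros; apply IHm; lia) Hsum) as H1.
      pose proof (Rmult_le_compat_l _ _ _ Hcb (Hsum m (le_n m))) as H2.
      unfold Rminus. eapply Rle_trans; [apply Rabs_triang|].
      rewrite !Rabs_Ropp, (Rabs_mult cb).
      apply Rle_trans with (INR (S m) * (D * (N * M)) + INR (S m) * (D * (Rabs cb * N))).
      + apply Rplus_le_compat.
        * eapply Rle_trans; [exact H1|]. right. unfold D. ring.
        * eapply Rle_trans; [exact H2|].
          replace (Rabs cb * (N * M * K ^ m)) with (1 * (D * (Rabs cb * N))) by (unfold D; ring).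
          apply Rmult_le_compat_r; [|exact HS].
          apply Rmult_le_pos; [lra|]. apply Rmult_le_pos; assumption.
      + rewrite <- Rmult_plus_distr_l, <- Rmult_plus_distr_l.
        apply Rmult_le_compat_l; [lra|]. apply Rmult_le_compat_l; [lra|]. unfold K. lra.
    - pose proof (PS_mult_bound (c (S i)) (c (S i)) M M K m
        ltac:(intros; apply IHm; lia) ltac:(intros; apply IHm; lia)) as H1.
      pose proof (Rmult_le_compat_l _ _ _ Hkn (IHm O m ltac:(lia) (le_n m))) as H2.
      eapply Rle_trans; [apply Rabs_triang|]. rewrite Rabs_Ropp, (Rabs_mult kn).
      apply Rle_trans with (INR (S m) * (D * M) + INR (S m) * (D * Rabs kn)).
      + apply Rplus_le_compat.
        * eapply Rle_trans; [exact H1|]. right. unfold D. ring.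
        * eapply Rle_trans; [exact H2|].
          replace (Rabs kn * (M * K ^ m)) with (1 * (D * Rabs kn)) by (unfold D; ring).
          apply Rmult_le_compat_r; [|exact HS]. apply Rmult_le_pos; lra.
      + rewrite <- Rmult_plus_distr_l, <- Rmult_plus_distr_l.
        apply Rmult_le_compat_l; [lra|]. apply Rmult_le_compat_l; [lra|].
        pose proof (Rmult_le_pos N M HN ltac:(lra)).
        pose proof (Rmult_le_pos _ N Hcb HN). unfold K. lra. }
  unfold c in Hb. rewrite <- PS_derive_taylor_coef in Hb. unfold PS_derive in Hb. fold c in Hb.
  rewrite Rabs_mult, (Rabs_pos_eq (INR (S m))) in Hb by lra.
  apply Rmult_le_reg_l in Hb; [|lra]. eapply Rle_trans; [exact Hb|].
  right. unfold D. simpl. ring.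
Qed.

(** The formal Taylor solution converges for |t| < 1/K. It lives on both sides of 0, since gluing
    will need a two-sided derivative at the junction. *)
Lemma local_existence (n : nat) (kn cb : R) (x0 : nat -> R) :
  (1 <= n)%nat ->
  exists (r : R) (X : nat -> R -> R), 0 < r /\
    (forall i, X i 0 = x0 i) /\
    forall t, Rabs t < r ->
      is_derive (X O) t (- X O t * sum_n_m (fun i => X i t) 1 n) /\
      forall i, (1 <= i <= n)%nat ->
        is_derive (X i) t (- (X i t) ^ 2 + kn * (X O t - cb)).
Proof.
  intros Hn.
  set (y0 := fun i : nat => match i with O => x0 O - cb | S _ => x0 i end).
  set (c := taylor_coef n kn cb y0).
  destruct (taylor_coef_geometric n kn cb y0) as [M [K [HK [HM Hc]]]]. fold c in Hc.
  exists (/ K), (fun i t => match i with O => PSeries (c O) t + cb | S _ => PSeries (c i) t end).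
  split; [apply Rinv_0_lt_compat, HK|]. split.
  { assert (H0 : forall i, PSeries (c i) 0 = y0 i).
    { intros i. rewrite PSeries_0. reflexivity. }
    intros [|i]; rewrite H0; simpl; ring. }
  intros t Ht.
  assert (Hrad : forall i, (i <= n)%nat -> Rbar_lt (Rabs t) (CV_radius (c i))).
  { intros i Hi. apply (CV_radius_gt_of_geometric _ M K); auto. }
  assert (Hps : forall i, (i <= n)%nat -> is_pseries (c i) t (PSeries (c i) t)).
  { intros i Hi. apply PSeries_correct, CV_radius_inside, Hrad, Hi. }
  assert (Hsum : is_pseries (fun j => sum_n_m (fun l => c l j) 1 n) t
                   (sum_n_m (fun l => PSeries (c l) t) 1 n)).
  { apply is_pseries_sum; [exact Hn|]. intros; apply Hps; lia. }
  assert (Hsumrad : Rbar_lt (Rabs t) (CV_radius (fun j => sum_n_m (fun l => c l j) 1 n))).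
  { apply (CV_radius_gt_of_geometric _ (INR n * M) K); [exact HK| |exact Ht].
    intros j. rewrite Rmult_assoc. apply sum_1_Rabs_le. intros; apply Hc; lia. }
  assert (Hder : forall i l, (i <= n)%nat ->
    is_pseries (system_coef n kn cb c i) t l -> is_derive (PSeries (c i)) t l).
  { intros i l Hi Hl. rewrite <- (is_pseries_unique _ _ _ Hl).
    rewrite <- (PSeries_ext (PS_derive (c i)) _ t).
    - apply is_derive_PSeries, Hrad, Hi.
    - intros m. apply PS_derive_taylor_coef. }
  split.
  - evar_last.
    + apply (is_derive_plus (PSeries (c O)) (fun _ => cb)); [|apply is_derive_const].
      apply Hder; [lia|].
      apply (is_pseries_ext (PS_plus (PS_opp (PS_mult (c O) (fun j => sum_n_m (fun l => c l j) 1 n)))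
        (PS_opp (PS_scal cb (fun j => sum_n_m (fun l => c l j) 1 n))))).
      { intros m. reflexivity. }
      apply is_pseries_plus; apply is_pseries_opp.
      * apply is_pseries_mult; [apply Hps; lia|exact Hsum|apply Hrad; lia|exact Hsumrad].
      * apply is_pseries_scal; [apply Rmult_comm|exact Hsum].
    + rewrite (sum_n_m_ext_loc
        (fun i => match i with O => PSeries (c O) t + cb | S _ => PSeries (c i) t end)
        (fun l => PSeries (c l) t)).
      * unfold plus, opp, scal, zero, mult; simpl. unfold mult; simpl. ring.
      * intros [|i] Hi; [lia|reflexivity].
  - intros [|i] Hi; [lia|]. evar_last.
    + apply (Hder (S i)); [lia|].
      apply (is_pseries_ext (PS_plus (PS_opp (PS_mult (c (S i)) (c (S i)))) (PS_scal kn (c O)))).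
      { intros m. reflexivity. }
      apply is_pseries_plus.
      * apply is_pseries_opp, is_pseries_mult; try apply Hps; try apply Hrad; lia.
      * apply is_pseries_scal; [apply Rmult_comm|apply Hps; lia].
    + unfold plus, opp, scal; simpl. unfold mult; simpl. ring.
Qed.

(* A left limit of both the function and its derivative suffices on the left, by the mean
   value theorem. *)
Lemma glue_is_derive (f df g : R -> R) (b d : R) :
  at_left b (fun t => is_derive f t (df t)) ->
  lim_left f b (g b) -> lim_left df b d -> is_derive g b d ->
  is_derive (fun t => if Rlt_dec t b then f t else g t) b d.
Proof.
  intros Hd Hf Hdf Hg.
  assert (Hq : lim_left (fun t => (f t - g b) / (b - t)) b (- d)).
  { apply (derive_lim_left_quotient (fun t => f t - g b) df).
    - revert Hd. apply filter_imp. intros t Ht.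
      replace (df t) with (df t - 0) by ring.
      exact (is_derive_minus f (fun _ => g b) t (df t) 0 Ht (is_derive_const (g b) t)).
    - rewrite <- (Rminus_diag (g b)). apply lim_left_minus; [exact Hf|apply lim_left_const].
    - exact Hdf. }
  apply is_derive_Reals. apply is_derive_Reals in Hg. intros eps Heps.
  destruct (Hg eps Heps) as [d1 Hd1].
  destruct (proj1 (at_left_iff _ _) (proj1 (lim_left_iff _ _ _) Hq eps Heps)) as [a [Hab Ha]].
  assert (Hpos : 0 < Rmin d1 (b - a)) by (apply Rmin_pos; [apply cond_pos|lra]).
  exists (mkposreal _ Hpos). intros h Hh Hhd. simpl in Hhd.
  destruct (Rlt_dec b b) as [|_]; [lra|].
  destruct (Rlt_dec (b + h) b) as [Hlt|Hge].
  - pose proof (Rmin_r d1 (b - a)). rewrite Rabs_left in Hhd by lra.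
    specialize (Ha (b + h) ltac:(lra)).
    rewrite <- Rabs_Ropp.
    replace (- ((f (b + h) - g b) / h - d)) with ((f (b + h) - g b) / (b - (b + h)) - - d)
      by (field; lra).
    exact Ha.
  - apply Hd1; [exact Hh|]. pose proof (Rmin_l d1 (b - a)). lra.
Qed.

Lemma lim_left_sum (f : nat -> R -> R) (l : nat -> R) (b : R) (m : nat) :
  (forall i, (1 <= i <= m)%nat -> lim_left (f i) b (l i)) ->
  lim_left (fun t => sum_n_m (fun i => f i t) 1 m) b (sum_n_m l 1 m).
Proof.
  induction m as [|m IH]; intros H.
  - rewrite sum_1_0. apply lim_left_ext with (fun _ => 0); [|apply lim_left_const].
    apply filter_forall. intros t. rewrite sum_1_0. reflexivity.
  - rewrite sum_1_S.
    apply lim_left_ext with (fun t => sum_n_m (fun i => f i t) 1 m + f (S m) t).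
    + apply filter_forall. intros t. rewrite sum_1_S. reflexivity.
    + apply lim_left_plus; [apply IH; intros; apply H; lia|apply H; lia].
Qed.

(** The limits serve as initial data of a local solution, which is glued to the given one at
    [tB]. *)
Lemma not_maximal_of_lim (n : nat) (k cb rho0 : R) (lam0 : nat -> R) (tB : R)
    (lam : nat -> R -> R) (rho : R -> R) (l : nat -> R) (r : R) :
  (1 <= n)%nat -> 0 < tB ->
  (forall i, (1 <= i <= n)%nat -> lim_left (lam i) tB (l i)) ->
  lim_left rho tB r ->
  ~ is_maximal_sol n k cb rho0 lam0 tB lam rho.
Proof.
  intros Hn HtB Hl Hr [[Hrho0 [Hlam0 [Hrhoc [Hlamc Hode]]]] Hmax].
  destruct (local_existence n (k / INR n) cb (fun i => match i with O => r | S _ => l i end) Hn)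
    as [e [X [He [HX0 HX]]]].
  (* The system is autonomous, so the local solution may be translated in time. *)
  set (Y := fun i t => X i (t - tB)).
  assert (HY0 : forall i, Y i tB = match i with O => r | S _ => l i end).
  { intros i. unfold Y. rewrite Rminus_diag. apply HX0. }
  assert (HY : forall t, Rabs (t - tB) < e ->
      is_derive (Y O) t (- Y O t * sum_n_m (fun i => Y i t) 1 n) /\
      forall i, (1 <= i <= n)%nat ->
        is_derive (Y i) t (- (Y i t) ^ 2 + k / INR n * (Y O t - cb))).
  { intros t Ht. destruct (HX _ Ht) as [H1 H2].
    assert (Hshift : forall (f : R -> R) (d : R),
      is_derive f (t - tB) d -> is_derive (fun t => f (t - tB)) t d).
    { intros f d Hf. evar_last.
      - apply (is_derive_comp f (fun t => t - tB) t _ 1 Hf). auto_derive; [exact I|ring].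
      - unfold scal; simpl. unfold mult; simpl. ring. }
    split; [apply Hshift, H1|intros i Hi; apply Hshift, H2, Hi]. }
  set (lam' := fun i t => if Rlt_dec t tB then lam i t else Y i t).
  set (rho' := fun t => if Rlt_dec t tB then rho t else Y O t).
  assert (Hleft : forall t, 0 < t < tB -> locally t (fun y => y < tB /\ 0 < y)).
  { intros t Ht. assert (Hp : 0 < Rmin t (tB - t)) by (apply Rmin_pos; lra).
    exists (mkposreal _ Hp). intros y Hy. change (Rabs (y - t) < Rmin t (tB - t)) in Hy.
    pose proof (Rmin_l t (tB - t)). pose proof (Rmin_r t (tB - t)).
    apply Rabs_def2 in Hy. lra. }
  assert (Hright0 : at_right 0 (fun t => t < tB)).
  { exists (mkposreal _ HtB). intros y Hy _. change (Rabs (y - 0) < tB) in Hy.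
    apply Rabs_def2 in Hy. lra. }
  apply (Hmax (tB + e) lam' rho').
  - lra.
  - unfold rho', lam'. split; [|split; [|split; [|split]]].
    + destruct (Rlt_dec 0 tB); [exact Hrho0|lra].
    + intros i Hi. destruct (Rlt_dec 0 tB); [apply Hlam0, Hi|lra].
    + apply filterlim_ext_loc with (2 := Hrhoc). revert Hright0. apply filter_imp.
      intros t Ht. destruct (Rlt_dec t tB); [reflexivity|lra].
    + intros i Hi. apply filterlim_ext_loc with (2 := Hlamc i Hi). revert Hright0.
      apply filter_imp. intros t Ht. destruct (Rlt_dec t tB); [reflexivity|lra].
    + intros t Ht. destruct (Rtotal_order t tB) as [Hlt|[Heq|Hgt]].
      * destruct (Rlt_dec t tB) as [_|]; [|lra].
        destruct (Hode t ltac:(lra)) as [H1 H2]. specialize (Hleft t ltac:(lra)).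
        assert (Hext : forall (f g : R -> R) (d : R), is_derive f t d ->
          is_derive (fun t => if Rlt_dec t tB then f t else g t) t d).
        { intros f g d Hf. apply is_derive_ext_loc with (2 := Hf). revert Hleft.
          apply filter_imp. intros y [Hy _]. destruct (Rlt_dec y tB); [reflexivity|lra]. }
        split; [apply Hext, H1|intros i Hi; apply Hext, H2, Hi].
      (* Only at the junction do the two pieces meet; their one-sided derivatives agree because the
         right-hand side is continuous in the values. *)
      * subst t. destruct (Rlt_dec tB tB) as [|_]; [lra|].
        destruct (HY tB) as [H1 H2]; [rewrite Rminus_diag, Rabs_R0; exact He|].
        assert (Hev : at_left tB (fun t => 0 < t < tB)) by (apply at_left_gt, HtB).
        split.
        -- apply (glue_is_derive rho (fun t => - rho t * sum_n_m (fun i => lam i t) 1 n)).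
           ++ revert Hev. apply filter_imp. intros t Ht0. apply Hode, Ht0.
           ++ rewrite HY0. exact Hr.
           ++ apply lim_left_mult; [rewrite HY0; apply lim_left_opp, Hr|].
              apply lim_left_sum. intros [|i] Hi; [lia|]. rewrite HY0. apply Hl, Hi.
           ++ exact H1.
        -- intros i Hi.
           apply (glue_is_derive (lam i) (fun t => - lam i t ^ 2 + k / INR n * (rho t - cb))).
           ++ revert Hev. apply filter_imp. intros t Ht0. apply Hode; [exact Ht0|exact Hi].
           ++ rewrite HY0. destruct i; [lia|]. apply Hl, Hi.
           ++ apply lim_left_plus.
              ** apply lim_left_opp. rewrite HY0. destruct i; [lia|].
                 apply (lim_left_comp (fun x => x ^ 2)); [|apply Hl, Hi].
                 apply (ex_derive_continuous (fun x => x ^ 2)). auto_derive. exact I.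
              ** apply lim_left_mult; [apply lim_left_const|].
                 apply lim_left_minus; [rewrite HY0; exact Hr|apply lim_left_const].
           ++ apply H2, Hi.
      * destruct (Rlt_dec t tB) as [|_]; [lra|].
        destruct (HY t) as [H1 H2]; [apply Rabs_def1; lra|].
        assert (Hnear : locally t (fun y => tB < y)) by (apply (open_gt tB), Hgt).
        assert (Hext : forall (f g : R -> R) (d : R), is_derive g t d ->
          is_derive (fun t => if Rlt_dec t tB then f t else g t) t d).
        { intros f g d Hf. apply is_derive_ext_loc with (2 := Hf). revert Hnear.
          apply filter_imp. intros y Hy. destruct (Rlt_dec y tB); [lra|reflexivity]. }
        split; [apply Hext, H1|]. intros i Hi. apply Hext, H2, Hi.
  - intros t Ht. unfold rho', lam'. destruct (Rlt_dec t tB); [auto|lra].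
Qed.

(** * Conserved quantities and the blow-up profile *)

(** The equations hold only for t > 0, so the constant is read off from the right limit at 0. *)
Lemma conserved_of_right_limit (f : R -> R) (T c : R) :
  filterlim f (at_right 0) (locally c) ->
  (forall t, 0 < t < T -> is_derive f t 0) ->
  forall t, 0 < t < T -> f t = c.
Proof.
  intros Hc Hd t Ht.
  apply (filterlim_locally_unique (F := at_right 0) f); [|exact Hc].
  apply filterlim_ext_loc with (fun _ => f t); [|apply filterlim_const].
  assert (Htp : 0 < t) by lra.
  exists (mkposreal _ Htp). intros y Hy Hy0.
  change (Rabs (y - 0) < t) in Hy. apply Rabs_def2 in Hy.
  destruct (mvt_derive f (fun _ => 0) y t) as [z [_ Hz]]; [lra| |lra].
  intros x Hx. apply Hd. lra.
Qed.

Lemma is_derive_sum_1 (f df : nat -> R -> R) (t : R) (m : nat) :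
  (forall i, (1 <= i <= m)%nat -> is_derive (f i) t (df i t)) ->
  is_derive (fun t => sum_n_m (fun i => f i t) 1 m) t (sum_n_m (fun i => df i t) 1 m).
Proof.
  induction m as [|m IH]; intros H.
  - rewrite sum_1_0. apply (is_derive_ext (fun _ => 0)).
    + intros y. rewrite sum_1_0. reflexivity.
    + exact (is_derive_const 0 t).
  - rewrite sum_1_S.
    apply (is_derive_ext (fun t => sum_n_m (fun i => f i t) 1 m + f (S m) t)).
    + intros y. rewrite sum_1_S. reflexivity.
    + apply (is_derive_plus (fun t => sum_n_m (fun i => f i t) 1 m) (f (S m)));
        [apply IH; intros; apply H; lia|apply H; lia].
Qed.

Lemma filterlim_sum_1_0 {F : (R -> Prop) -> Prop} {FF : Filter F} (f : nat -> R -> R) (m : nat) :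
  (forall i, (1 <= i <= m)%nat -> filterlim (f i) F (locally 0)) ->
  filterlim (fun t => sum_n_m (fun i => f i t) 1 m) F (locally 0).
Proof.
  induction m as [|m IH]; intros H.
  - apply filterlim_ext with (fun _ => 0); [|apply filterlim_const].
    intros y. rewrite sum_1_0. reflexivity.
  - apply filterlim_ext with (fun t => sum_n_m (fun i => f i t) 1 m + f (S m) t).
    + intros y. rewrite sum_1_S. reflexivity.
    + rewrite <- (Rplus_0_l 0).
      apply (filterlim_comp_2 (F := F) _ (f (S m)) Rplus (IH ltac:(intros; apply H; lia)) (H (S m) ltac:(lia))).
      apply (filterlim_plus 0 0).
Qed.

Lemma sum_1_minus (f g : nat -> R) (m : nat) :
  sum_n_m (fun i => f i - g i) 1 m = sum_n_m f 1 m - sum_n_m g 1 m :> R.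
Proof.
  induction m as [|m IH]; [rewrite !sum_1_0; ring|]. rewrite !sum_1_S, IH. ring.
Qed.

Lemma sum_1_scal (c : R) (f : nat -> R) (m : nat) :
  sum_n_m (fun i => c * f i) 1 m = c * sum_n_m f 1 m :> R.
Proof.
  induction m as [|m IH]; [rewrite !sum_1_0; ring|]. rewrite !sum_1_S, IH. ring.
Qed.

Definition step (J : nat) (a b : R) (i : nat) : R := if le_lt_dec i J then a else b.

Lemma sum_1_step (a b : R) (J m : nat) : (J <= m)%nat ->
  sum_n_m (fun i => step J a b i) 1 m = INR J * a + INR (m - J) * b :> R.
Proof.
  induction m as [|m IH]; intros Hm.
  - rewrite sum_1_0. replace J with O by lia. simpl. ring.
  - rewrite sum_1_S. unfold step at 2. destruct (le_lt_dec (S m) J) as [H|H].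
    + rewrite (sum_n_m_ext_loc _ (fun _ => a)).
      * rewrite sum_n_m_const. assert (J = S m) as -> by lia. rewrite Nat.sub_diag.
        replace (S m - 1)%nat with m by lia. rewrite S_INR. simpl (INR 0). ring.
      * intros i Hi. unfold step. destruct (le_lt_dec i J); [reflexivity|lia].
    + rewrite IH by lia. replace (S m - J)%nat with (S (m - J)) by lia. rewrite S_INR. ring.
Qed.

(** The logarithm of u_i; products of the u_i become sums, and their positivity is automatic. *)
Definition primitive (lam : nat -> R -> R) (i : nat) (t : R) : R := RInt (lam i) 0 t.

Section Solution.

Variables (n : nat) (k cb rho0 : R) (lam0 : nat -> R) (tB : R).
Variables (lam : nat -> R -> R) (rho : R -> R).
Hypothesis HtB : 0 < tB.
Hypothesis Hsol : is_sol n k cb rho0 lam0 tB lam rho.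

Local Notation Lam := (primitive lam).

Lemma lam_derive i t : (1 <= i <= n)%nat -> 0 < t < tB ->
  is_derive (lam i) t (- (lam i t) ^ 2 + k / INR n * (rho t - cb)).
Proof. intros Hi Ht. apply Hsol; assumption. Qed.

(** Nothing is known of [lam i] at negative times, so it is frozen there at its initial value. The
    result is continuous across 0, and its integral from 0 is unchanged for t >= 0. *)
Lemma clamped_lam_continuous i t : (1 <= i <= n)%nat -> t < tB ->
  continuous (fun y => lam i (Rmax 0 y)) t.
Proof.
  intros Hi Ht. destruct Hsol as [_ [H0 [_ [Hright Hode]]]].
  destruct (Rtotal_order t 0) as [Hneg|[->|Hpos]].
  - apply (continuous_ext_loc _ (fun _ => lam i 0)); [|apply continuous_const].
    generalize (open_lt 0 t Hneg). apply filter_imp. intros y Hy.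
    rewrite Rmax_left; [reflexivity|lra].
  - unfold continuous. rewrite Rmax_left, (H0 i Hi) by lra.
    apply filterlim_locally. intros eps.
    destruct (proj1 (filterlim_locally _ _) (Hright i Hi) eps) as [d Hd].
    exists d. intros y Hy. destruct (Rle_lt_dec y 0) as [Hy0|Hy0].
    + rewrite Rmax_left, (H0 i Hi) by lra. apply ball_center.
    + rewrite Rmax_right by lra. apply Hd; assumption.
  - apply (continuous_ext_loc _ (lam i)).
    + generalize (open_gt 0 t Hpos). apply filter_imp. intros y Hy.
      rewrite Rmax_right; [reflexivity|lra].
    + apply (ex_derive_continuous (lam i)). eexists. apply lam_derive; [exact Hi|lra].
Qed.

Lemma clamped_lam_is_RInt i t : (1 <= i <= n)%nat -> t < tB ->
  is_RInt (fun y => lam i (Rmax 0 y)) 0 t (RInt (fun y => lam i (Rmax 0 y)) 0 t).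
Proof.
  intros Hi Ht. apply (RInt_correct (V := R_CompleteNormedModule)).
  apply (ex_RInt_continuous (V := R_CompleteNormedModule)).
  intros z Hz. apply clamped_lam_continuous; [exact Hi|].
  eapply Rle_lt_trans; [apply Hz|]. apply Rmax_lub_lt; assumption.
Qed.

Lemma clamped_Lam i t : 0 <= t -> RInt (fun y => lam i (Rmax 0 y)) 0 t = Lam i t.
Proof.
  intros Ht. apply RInt_ext. intros y Hy. rewrite Rmin_left in Hy by exact Ht.
  rewrite Rmax_right; [reflexivity|lra].
Qed.

Lemma lam_is_RInt i t : (1 <= i <= n)%nat -> 0 <= t < tB -> is_RInt (lam i) 0 t (Lam i t).
Proof.
  intros Hi Ht. apply is_RInt_ext with (fun y => lam i (Rmax 0 y)).
  - intros y Hy. rewrite Rmin_left in Hy by apply Ht. rewrite Rmax_right; [reflexivity|lra].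
  - rewrite <- clamped_Lam by apply Ht. apply clamped_lam_is_RInt; [exact Hi|apply Ht].
Qed.

Lemma clamped_Lam_derive i t : (1 <= i <= n)%nat -> t < tB ->
  is_derive (fun t => RInt (fun y => lam i (Rmax 0 y)) 0 t) t (lam i (Rmax 0 t)).
Proof.
  intros Hi Ht.
  apply (is_derive_RInt (fun y => lam i (Rmax 0 y)) _ 0 t).
  - generalize (open_lt tB t Ht). apply filter_imp. intros y Hy.
    apply clamped_lam_is_RInt; assumption.
  - apply clamped_lam_continuous; assumption.
Qed.

Lemma Lam_derive i t : (1 <= i <= n)%nat -> 0 < t < tB -> is_derive (Lam i) t (lam i t).
Proof.
  intros Hi Ht. rewrite <- (Rmax_right 0 t) at 2 by lra.
  apply (is_derive_ext_loc (fun t => RInt (fun y => lam i (Rmax 0 y)) 0 t)).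
  - generalize (open_gt 0 t (proj1 Ht)). apply filter_imp. intros y Hy.
    apply clamped_Lam. lra.
  - apply clamped_Lam_derive; [exact Hi|lra].
Qed.

Lemma Lam_right_0 i : (1 <= i <= n)%nat -> filterlim (Lam i) (at_right 0) (locally 0).
Proof.
  intros Hi.
  apply filterlim_ext_loc with (fun t => RInt (fun y => lam i (Rmax 0 y)) 0 t).
  - exists (mkposreal 1 Rlt_0_1). intros y _ Hy. apply clamped_Lam. lra.
  - apply (filterlim_filter_le_1 (F := locally 0)); [intros P HP; apply filter_le_within; exact HP|].
    pose proof (ex_derive_continuous _ _ (ex_intro _ _ (clamped_Lam_derive i 0 Hi HtB))) as H.
    unfold continuous in H. rewrite RInt_point in H. exact H.
Qed.

(** The Wronskian in the form u_i u_j (lambda_j - lambda_i): the order of the lambdas is visibly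
    that of their initial values. *)
Lemma wronskian_conserved i j t : (1 <= i <= n)%nat -> (1 <= j <= n)%nat -> 0 < t < tB ->
  exp (Lam i t + Lam j t) * (lam j t - lam i t) = lam0 j - lam0 i.
Proof.
  intros Hi Hj.
  apply (conserved_of_right_limit (fun t => exp (Lam i t + Lam j t) * (lam j t - lam i t)) tB).
  - replace (lam0 j - lam0 i) with (exp (0 + 0) * (lam0 j + - lam0 i))
      by (rewrite Rplus_0_l, exp_0; ring).
    apply (filterlim_comp_2 (fun t => exp (Lam i t + Lam j t)) (fun t => lam j t - lam i t) Rmult
      (G := locally (exp (0 + 0))) (H := locally (lam0 j + - lam0 i))).
    + apply (filterlim_comp _ _ _ (fun t => Lam i t + Lam j t) exp _ (locally (0 + 0))).
      * apply (filterlim_comp_2 (Lam i) (Lam j) Rplus (Lam_right_0 i Hi) (Lam_right_0 j Hj)).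
        apply (filterlim_plus 0 0).
      * apply (ex_derive_continuous exp (0 + 0)). auto_derive. exact I.
    + destruct Hsol as [_ [_ [_ [Hr _]]]].
      apply (filterlim_comp_2 (lam j) (fun t => - lam i t) Rplus (H := locally (- lam0 i)) (Hr j Hj)).
      * apply (filterlim_comp _ _ _ (lam i) Ropp _ _ _ (Hr i Hi) (filterlim_opp (lam0 i))).
      * apply (filterlim_plus (lam0 j) (- lam0 i)).
    + apply (filterlim_mult (exp (0 + 0)) (lam0 j + - lam0 i)).
  (* The common forcing term cancels in lambda_j' - lambda_i', and the difference of squares cancels
     against the derivative of the exponential. *)
  - intros y Hy.
    pose proof (Lam_derive i y Hi Hy) as D1. pose proof (Lam_derive j y Hj Hy) as D2.
    pose proof (lam_derive i y Hi Hy) as D3. pose proof (lam_derive j y Hj Hy) as D4.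
    auto_derive.
    + repeat split; try (eexists; eassumption).
    + replace (Derive (fun x => Lam i x) y) with (lam i y) by (symmetry; apply is_derive_unique, D1).
      replace (Derive (fun x => Lam j x) y) with (lam j y) by (symmetry; apply is_derive_unique, D2).
      replace (Derive (fun x => lam i x) y) with (- (lam i y) ^ 2 + k / INR n * (rho y - cb))
        by (symmetry; apply is_derive_unique, D3).
      replace (Derive (fun x => lam j x) y) with (- (lam j y) ^ 2 + k / INR n * (rho y - cb))
        by (symmetry; apply is_derive_unique, D4).
      ring.
Qed.

Lemma sum_Lam_derive t : 0 < t < tB ->
  is_derive (fun t => sum_n_m (fun i => Lam i t) 1 n) t (sum_n_m (fun i => lam i t) 1 n).
Proof. intros Ht. apply is_derive_sum_1. intros i Hi. apply Lam_derive; assumption. Qed.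

Lemma rho_eq t : 0 < t < tB -> rho t = rho0 * exp (- sum_n_m (fun i => Lam i t) 1 n).
Proof.
  intros Ht.
  assert (H : rho t * exp (sum_n_m (fun i => Lam i t) 1 n) = rho0).
  { apply (conserved_of_right_limit (fun t => rho t * exp (sum_n_m (fun i => Lam i t) 1 n)) tB);
      [| |exact Ht].
    - destruct Hsol as [_ [_ [Hr _]]].
      replace rho0 with (rho0 * exp 0) by (rewrite exp_0; ring).
      apply (filterlim_comp_2 rho (fun t => exp (sum_n_m (fun i => Lam i t) 1 n)) Rmult
        (H := locally (exp 0)) Hr).
      + apply (filterlim_comp _ _ _ (fun t => sum_n_m (fun i => Lam i t) 1 n) exp _ (locally 0)).
        * apply filterlim_sum_1_0. exact Lam_right_0.
        * apply (ex_derive_continuous exp 0). auto_derive. exact I.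
      + apply (filterlim_mult rho0 (exp 0)).
    - intros y Hy. pose proof (sum_Lam_derive y Hy) as D1.
      destruct Hsol as [_ [_ [_ [_ Hode]]]]. destruct (Hode y Hy) as [D2 _].
      set (S := fun t => sum_n_m (fun i => Lam i t) 1 n) in *.
      change (is_derive (fun t => rho t * exp (S t)) y 0).
      auto_derive.
      + repeat split; eexists; eassumption.
      + replace (Derive (fun x => S x) y) with (sum_n_m (fun i => lam i y) 1 n)
          by (symmetry; apply is_derive_unique, D1).
        replace (Derive (fun x => rho x) y) with (- rho y * sum_n_m (fun i => lam i y) 1 n)
          by (symmetry; apply is_derive_unique, D2).
        ring. }
  rewrite exp_Ropp, <- H. field. pose proof (exp_pos (sum_n_m (fun i => Lam i t) 1 n)). lra.
Qed.

Lemma lam_initial i : (1 <= i <= n)%nat -> lam i 0 = lam0 i.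
Proof. apply Hsol. Qed.

(** * Ordering of the lambda_i and vanishing of u_1 u_n *)

Variables (J : nat) (p q : R).
Hypothesis Hk : 0 < k.
Hypothesis Hrho0 : 0 < rho0.
Hypothesis HJ : (1 <= J <= n)%nat.
Hypothesis Hlow : forall i, (1 <= i <= J)%nat -> lam0 i = lam0 1%nat.
Hypothesis Hhigh : forall i, (J < i <= n)%nat -> lam0 1%nat < lam0 i <= lam0 n.
Hypothesis Hq : 0 <= q.
Hypothesis Hpq : q < p.
Hypothesis Hlim1 : lim_left (fun t => exp (Lam 1%nat t + Lam n t) * lam 1%nat t) tB (- p).
Hypothesis Hlimn : lim_left (fun t => exp (Lam 1%nat t + Lam n t) * lam n t) tB q.
Hypothesis Hmax : is_maximal_sol n k cb rho0 lam0 tB lam rho.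

Local Notation xi1 := (- p / (p - q)).
Local Notation xin := (q / (p - q)).
Local Notation Prod t := (exp (Lam 1%nat t + Lam n t)).
Local Notation Sum f t := (sum_n_m (fun i => f i t) 1 n).

Lemma one_le_n : (1 <= 1 <= n)%nat.
Proof. lia. Qed.

Lemma n_le_n : (1 <= n <= n)%nat.
Proof. lia. Qed.

Lemma INR_n_pos : 0 < INR n.
Proof. apply lt_0_INR. lia. Qed.

Lemma near_tB (P : R -> Prop) : (forall t, 0 < t < tB -> P t) -> at_left tB P.
Proof. intros H. apply at_left_iff. exists 0. auto. Qed.

Lemma wronskian_1n : lam0 n - lam0 1%nat = p + q.
Proof.
  apply (lim_left_unique (fun t => Prod t * lam n t - Prod t * lam 1%nat t) tB).
  - apply lim_left_ext with (fun _ => lam0 n - lam0 1%nat); [|apply lim_left_const].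
    apply near_tB. intros t Ht.
    rewrite <- (wronskian_conserved 1 n t one_le_n n_le_n Ht). ring.
  - replace (p + q) with (q - - p) by ring. apply lim_left_minus; assumption.
Qed.

(** If all initial values agreed, the Wronskian of u_1 and u_n would vanish, but it equals p + q >
    0. *)
Lemma J_lt_n : (J < n)%nat.
Proof.
  destruct (Nat.eq_dec J n) as [E|E]; [exfalso|lia].
  pose proof wronskian_1n as H. rewrite (Hlow n) in H by lia. lra.
Qed.

Lemma lam_low i t : (1 <= i <= J)%nat -> 0 < t < tB -> lam i t = lam 1%nat t.
Proof.
  intros Hi Ht.
  pose proof (wronskian_conserved 1 i t one_le_n ltac:(lia) Ht) as H.
  rewrite (Hlow i Hi), Rminus_diag in H.
  pose proof (exp_pos (Lam 1%nat t + Lam i t)).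
  apply Rmult_integral in H. lra.
Qed.

Lemma lam_high i t : (J < i <= n)%nat -> 0 < t < tB -> lam 1%nat t < lam i t <= lam n t.
Proof.
  intros Hi Ht. pose proof (Hhigh i Hi).
  pose proof (wronskian_conserved 1 i t one_le_n ltac:(lia) Ht) as H1.
  pose proof (wronskian_conserved i n t ltac:(lia) n_le_n Ht) as H2.
  pose proof (exp_pos (Lam 1%nat t + Lam i t)). pose proof (exp_pos (Lam i t + Lam n t)).
  split.
  - apply Rnot_le_lt. intros Hle.
    pose proof (Rmult_le_pos (exp (Lam 1%nat t + Lam i t)) (lam 1%nat t - lam i t)
      ltac:(lra) ltac:(lra)). lra.
  - apply Rnot_lt_le. intros Hlt.
    pose proof (Rmult_lt_0_compat (exp (Lam i t + Lam n t)) (lam i t - lam n t)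
      ltac:(lra) ltac:(lra)). lra.
Qed.

Lemma lam_between i t : (1 <= i <= n)%nat -> 0 < t < tB -> lam 1%nat t <= lam i t <= lam n t.
Proof.
  intros Hi Ht. destruct (le_lt_dec i J) as [HiJ|HiJ].
  - rewrite (lam_low i t) by (lia || lra). pose proof J_lt_n.
    pose proof (lam_high n t ltac:(lia) Ht). lra.
  - pose proof (lam_high i t ltac:(lia) Ht). lra.
Qed.

Lemma Prod_derive t : 0 < t < tB ->
  is_derive (fun t => Prod t) t (Prod t * lam 1%nat t + Prod t * lam n t).
Proof.
  intros Ht.
  pose proof (Lam_derive 1 t one_le_n Ht) as D1. pose proof (Lam_derive n t n_le_n Ht) as D2.
  auto_derive.
  - repeat split; eexists; eassumption.
  - replace (Derive (fun x => Lam 1%nat x) t) with (lam 1%nat t)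
      by (symmetry; apply is_derive_unique, D1).
    replace (Derive (fun x => Lam n x) t) with (lam n t)
      by (symmetry; apply is_derive_unique, D2).
    ring.
Qed.

Lemma Prod_derivative_lim :
  lim_left (fun t => Prod t * lam 1%nat t + Prod t * lam n t) tB (- p + q).
Proof. apply lim_left_plus; assumption. Qed.

Lemma finite_choice (Q : nat -> R -> Prop) (m : nat) :
  (forall i, (1 <= i <= m)%nat -> exists l, Q i l) ->
  exists l : nat -> R, forall i, (1 <= i <= m)%nat -> Q i (l i).
Proof.
  induction m as [|m IH]; intros H.
  - exists (fun _ => 0). intros; lia.
  - destruct IH as [l Hl]; [intros; apply H; lia|].
    destruct (H (S m) ltac:(lia)) as [x Hx].
    exists (fun i => if Nat.eq_dec i (S m) then x else l i).
    intros i Hi. destruct (Nat.eq_dec i (S m)) as [->|]; [exact Hx|apply Hl; lia].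
Qed.

(** A bootstrap: by the ordering all [lam i] are bounded, so their primitives converge, hence so
    does [rho]; then the derivatives of the [lam i] are bounded and the [lam i] converge too,
    against maximality. *)
Lemma lam_1_n_not_both_convergent a b :
  lim_left (lam 1%nat) tB a -> lim_left (lam n) tB b -> False.
Proof.
  intros Ha Hb.
  set (M := Rabs a + Rabs b + 1).
  assert (Hbound : forall i, (1 <= i <= n)%nat -> at_left tB (fun t => Rabs (lam i t) <= M)).
  { intros i Hi.
    generalize (at_left_and (at_left_gt 0 tB HtB) (at_left_and
      (lim_left_gt _ _ _ (a - 1) Ha ltac:(lra)) (lim_left_lt _ _ _ (b + 1) Hb ltac:(lra)))).
    apply filter_imp. intros t [Ht [H1 H2]].
    pose proof (lam_between i t Hi Ht).
    pose proof (Rle_abs b). pose proof (Rle_abs (- a)) as Ha'. rewrite Rabs_Ropp in Ha'.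
    pose proof (Rabs_pos a). pose proof (Rabs_pos b).
    apply Rabs_le. unfold M. lra. }
  destruct (finite_choice (fun i l => lim_left (Lam i) tB l) n) as [L HL].
  { intros i Hi. apply (derive_bounded_lim_left _ (lam i) tB M); [|apply Hbound, Hi].
    apply near_tB. intros t Ht. apply Lam_derive; assumption. }
  assert (Hrho : lim_left rho tB (rho0 * exp (- sum_n_m L 1 n))).
  { apply lim_left_ext with (fun t => rho0 * exp (- Sum Lam t)).
    - apply near_tB. intros t Ht. symmetry. apply rho_eq, Ht.
    - apply lim_left_mult; [apply lim_left_const|].
      apply (lim_left_comp exp).
      + apply (ex_derive_continuous exp). auto_derive. exact I.
      + apply lim_left_opp. apply (lim_left_sum Lam L). exact HL. }
  set (r := rho0 * exp (- sum_n_m L 1 n)) in *.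
  destruct (finite_choice (fun i l => lim_left (lam i) tB l) n) as [l Hl].
  { intros i Hi.
    apply (derive_bounded_lim_left _ (fun t => - lam i t ^ 2 + k / INR n * (rho t - cb)) tB
      (M ^ 2 + k / INR n * (Rabs (r - cb) + 1))).
    - apply near_tB. intros t Ht. apply lam_derive; assumption.
    - generalize (at_left_and (Hbound i Hi) (proj1 (lim_left_iff _ _ _) Hrho 1 Rlt_0_1)).
      apply filter_imp. intros t [H1 H2].
      assert (Hkn : 0 <= k / INR n).
      { apply Rmult_le_pos; [lra|]. left. apply Rinv_0_lt_compat, INR_n_pos. }
      eapply Rle_trans; [apply Rabs_triang|].
      rewrite Rabs_Ropp, <- RPow_abs, Rabs_mult, (Rabs_pos_eq (k / INR n)) by exact Hkn.
      apply Rplus_le_compat.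
      + apply pow_incr. split; [apply Rabs_pos|exact H1].
      + apply Rmult_le_compat_l; [exact Hkn|].
        replace (rho t - cb) with ((r - cb) + (rho t - r)) by ring.
        eapply Rle_trans; [apply Rabs_triang|]. lra. }
  exact (not_maximal_of_lim n k cb rho0 lam0 tB lam rho l r (proj2 one_le_n) HtB Hl Hrho Hmax).
Qed.

Lemma Prod_lim_0 : lim_left (fun t => Prod t) tB 0.
Proof.
  destruct (derive_bounded_lim_left (fun t => Prod t)
    (fun t => Prod t * lam 1%nat t + Prod t * lam n t) tB (Rabs (- p + q) + 1)) as [L HL].
  - apply near_tB. exact Prod_derive.
  - generalize (proj1 (lim_left_iff _ _ _) Prod_derivative_lim 1 Rlt_0_1).
    apply filter_imp. intros t Ht.
    replace (Prod t * lam 1%nat t + Prod t * lam n t)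
      with ((- p + q) + (Prod t * lam 1%nat t + Prod t * lam n t - (- p + q))) by ring.
    eapply Rle_trans; [apply Rabs_triang|]. lra.
  - assert (H0 : 0 <= L).
    { apply (lim_left_ge_bound _ _ _ _ HL). apply near_tB. intros. left. apply exp_pos. }
    destruct H0 as [Hpos|<-]; [exfalso|exact HL].
    apply (lam_1_n_not_both_convergent (- p / L) (q / L)).
    + apply lim_left_ext with (fun t => Prod t * lam 1%nat t / Prod t).
      * apply near_tB. intros t _. field. pose proof (exp_pos (Lam 1%nat t + Lam n t)). lra.
      * apply lim_left_div; [lra|exact Hlim1|exact HL].
    + apply lim_left_ext with (fun t => Prod t * lam n t / Prod t).
      * apply near_tB. intros t _. field. pose proof (exp_pos (Lam 1%nat t + Lam n t)). lra.
      * apply lim_left_div; [lra|exact Hlimn|exact HL].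
Qed.

Lemma Prod_equiv : lim_left (fun t => Prod t / (tB - t)) tB (p - q).
Proof.
  replace (p - q) with (- (- p + q)) by ring.
  apply (derive_lim_left_quotient _ (fun t => Prod t * lam 1%nat t + Prod t * lam n t)).
  - apply near_tB. exact Prod_derive.
  - exact Prod_lim_0.
  - exact Prod_derivative_lim.
Qed.

Lemma scaled_lim_of_Prod (f : R -> R) l :
  lim_left (fun t => Prod t * f t) tB l -> lim_left (fun t => (tB - t) * f t) tB (l / (p - q)).
Proof.
  intros H.
  apply lim_left_ext with (fun t => (Prod t * f t) / (Prod t / (tB - t))).
  - apply near_tB. intros t Ht. field. split; [lra|].
    pose proof (exp_pos (Lam 1%nat t + Lam n t)). lra.
  - apply lim_left_div; [lra|exact H|exact Prod_equiv].
Qed.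

Lemma remaining_over_Prod : lim_left (fun t => (tB - t) / Prod t) tB (/ (p - q)).
Proof.
  rewrite <- (Rmult_1_l (/ (p - q))).
  apply lim_left_ext with (fun t => (tB - t) * / Prod t); [apply filter_forall; reflexivity|].
  apply (scaled_lim_of_Prod (fun t => / Prod t) 1).
  apply lim_left_ext with (fun _ => 1); [|apply lim_left_const].
  apply near_tB. intros t _. field. pose proof (exp_pos (Lam 1%nat t + Lam n t)). lra.
Qed.

(** * Scaled limits of the lambda_i and ratios of the u_i *)

Lemma scaled_lam_1 : lim_left (fun t => (tB - t) * lam 1%nat t) tB xi1.
Proof. exact (scaled_lim_of_Prod _ _ Hlim1). Qed.

Lemma scaled_lam_n : lim_left (fun t => (tB - t) * lam n t) tB xin.
Proof. exact (scaled_lim_of_Prod _ _ Hlimn). Qed.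

(** The scaled derivative tends to xi_n - xi_1 = (p + q) / (p - q) > 0. That u_n / u_1 is unbounded
    makes the differences among the upper lambdas negligible. *)
Lemma ratio_pinfty : lim_left_pinfty (fun t => Lam n t - Lam 1%nat t) tB.
Proof.
  assert (Hc : 0 < (p + q) / (p - q)) by (apply Rdiv_lt_0_compat; lra).
  apply (log_derivative_pinfty _ (fun t => lam n t - lam 1%nat t) tB ((p + q) / (p - q) / 2));
    [lra| |].
  - apply near_tB. intros t Ht.
    exact (is_derive_minus _ _ t _ _ (Lam_derive n t n_le_n Ht) (Lam_derive 1 t one_le_n Ht)).
  - generalize (lim_left_gt _ _ _ ((p + q) / (p - q) / 2)
      (lim_left_minus _ _ _ _ _ scaled_lam_n scaled_lam_1)
      ltac:(replace (xin - xi1) with ((p + q) / (p - q)) by (field; lra); lra)).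
    apply filter_imp. intros t Ht. lra.
Qed.

(** A quotient of two Wronskians with u_1; for i > J it turns out to be the limit of u_i / u_n. *)
Local Notation beta i := ((lam0 i - lam0 1%nat) / (lam0 n - lam0 1%nat)).

Lemma beta_pos i : (J < i <= n)%nat -> 0 < beta i.
Proof. intros Hi. pose proof (Hhigh i Hi). apply Rdiv_lt_0_compat; lra. Qed.

(* Both sides are compared with the Wronskians of the pairs [(1, i)] and [(1, n)]. *)
Lemma exp_Lam_ratio i t : (J < i <= n)%nat -> 0 < t < tB ->
  exp (Lam i t - Lam n t) = beta i * ((lam n t - lam 1%nat t) / (lam i t - lam 1%nat t)).
Proof.
  intros Hi Ht. pose proof (lam_high i t Hi Ht).
  rewrite <- (wronskian_conserved 1 i t one_le_n ltac:(lia) Ht).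
  rewrite <- (wronskian_conserved 1 n t one_le_n n_le_n Ht).
  replace (Lam i t - Lam n t) with ((Lam 1%nat t + Lam i t) + - (Lam 1%nat t + Lam n t)) by ring.
  rewrite (exp_plus (Lam 1%nat t + Lam i t)), exp_Ropp.
  field. repeat split; try lra. pose proof (exp_pos (Lam 1%nat t + Lam n t)). lra.
Qed.

Lemma exp_Lam_ratio_ge i t : (J < i <= n)%nat -> 0 < t < tB ->
  beta i <= exp (Lam i t - Lam n t).
Proof.
  intros Hi Ht. rewrite exp_Lam_ratio by assumption.
  pose proof (lam_high i t Hi Ht). pose proof (beta_pos i Hi).
  rewrite <- (Rmult_1_r (beta i)) at 1. apply Rmult_le_compat_l; [lra|].
  apply Rmult_le_reg_r with (lam i t - lam 1%nat t); [lra|].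
  unfold Rdiv. rewrite Rmult_assoc, Rinv_l by lra. lra.
Qed.

(** The Wronskian of u_i and u_n is constant and u_i >= beta_i u_n, so the difference is of order
    u_n^(-2). *)
Lemma lam_n_minus_lam i t : (J < i <= n)%nat -> 0 < t < tB ->
  0 <= lam n t - lam i t <= (lam0 n - lam0 i) / beta i * exp (- (2 * Lam n t)).
Proof.
  intros Hi Ht. pose proof (lam_high i t Hi Ht). split; [lra|].
  pose proof (wronskian_conserved i n t ltac:(lia) n_le_n Ht) as HW.
  pose proof (exp_Lam_ratio_ge i t Hi Ht) as Hge. pose proof (beta_pos i Hi) as Hb.
  pose proof (Hhigh i Hi).
  replace (lam n t - lam i t)
    with ((lam0 n - lam0 i) * / exp (Lam i t - Lam n t) * exp (- (2 * Lam n t))).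
  - apply Rmult_le_compat_r; [left; apply exp_pos|].
    apply Rmult_le_compat_l; [lra|]. apply Rinv_le_contravar; assumption.
  - rewrite <- HW.
    replace (Lam i t + Lam n t) with ((Lam i t - Lam n t) + 2 * Lam n t) by ring.
    rewrite exp_plus, exp_Ropp. field.
    split; apply Rgt_not_eq, exp_pos.
Qed.

Lemma scaled_lam_high i : (J < i <= n)%nat -> lim_left (fun t => (tB - t) * lam i t) tB xin.
Proof.
  intros Hi.
  apply lim_left_ext with (fun t => (tB - t) * lam n t - (tB - t) * (lam n t - lam i t)).
  { apply filter_forall. intros; ring. }
  rewrite <- (Rminus_0_r xin). apply lim_left_minus; [exact scaled_lam_n|].
  set (C := (lam0 n - lam0 i) / beta i).
  (* Here s u_n^(-2) is written as (s / (u_1 u_n)) (u_1 / u_n), a convergent factor times one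
     tending to 0; no bound on u_n alone is available yet. *)
  apply lim_left_squeeze with (fun _ => 0)
    (fun t => C * ((tB - t) / Prod t * exp (- (Lam n t - Lam 1%nat t)))).
  - apply near_tB. intros t Ht. pose proof (lam_n_minus_lam i t Hi Ht) as [H1 H2]. split.
    + apply Rmult_le_pos; lra.
    + replace (C * ((tB - t) / Prod t * exp (- (Lam n t - Lam 1%nat t))))
        with ((tB - t) * (C * exp (- (2 * Lam n t)))).
      * apply Rmult_le_compat_l; [lra|exact H2].
      * replace (- (2 * Lam n t))
          with (- (Lam 1%nat t + Lam n t) + - (Lam n t - Lam 1%nat t)) by ring.
        rewrite exp_plus, (exp_Ropp (Lam 1%nat t + Lam n t)). unfold Rdiv. ring.
  - apply lim_left_const.
  - replace 0 with (C * (/ (p - q) * 0)) by ring.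
    apply lim_left_mult; [apply lim_left_const|].
    apply lim_left_mult; [exact remaining_over_Prod|].
    apply lim_left_exp_opp_pinfty, ratio_pinfty.
Qed.

Local Notation xi i := (step J xi1 xin i).

Lemma scaled_lam i : (1 <= i <= n)%nat -> lim_left (fun t => (tB - t) * lam i t) tB (xi i).
Proof.
  intros Hi. unfold step. destruct (le_lt_dec i J) as [HiJ|HiJ].
  - apply lim_left_ext with (2 := scaled_lam_1). apply near_tB. intros t Ht.
    rewrite (lam_low i t); [reflexivity|lia|exact Ht].
  - apply scaled_lam_high. lia.
Qed.

(** After scaling by s, lambda_n - lambda_1 and lambda_i - lambda_1 have the same nonzero limit, so
    their quotient tends to 1. *)
Lemma Lam_ratio_lim i : (J < i <= n)%nat ->
  lim_left (fun t => Lam i t - Lam n t) tB (ln (beta i)).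
Proof.
  intros Hi. pose proof (beta_pos i Hi) as Hb.
  apply lim_left_ext with (fun t => ln (exp (Lam i t - Lam n t))).
  { apply filter_forall. intros t. apply ln_exp. }
  apply (lim_left_comp ln).
  { apply (ex_derive_continuous ln). auto_derive. exact Hb. }
  set (c := (p + q) / (p - q)). assert (Hc : 0 < c) by (apply Rdiv_lt_0_compat; lra).
  apply lim_left_ext with (fun t => beta i *
    (((tB - t) * lam n t - (tB - t) * lam 1%nat t) / ((tB - t) * lam i t - (tB - t) * lam 1%nat t))).
  { apply near_tB. intros t Ht. rewrite exp_Lam_ratio by assumption.
    pose proof (lam_high i t Hi Ht). rewrite <- !Rmult_minus_distr_l.
    pose proof (Hhigh i Hi). field. repeat split; lra. }
  assert (Hx : xin - xi1 = c) by (unfold c; field; lra).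
  assert (Hone : (xin - xi1) / (xin - xi1) = 1) by (rewrite Hx; field; lra).
  evar_last.
  - apply lim_left_mult; [apply lim_left_const|].
    apply (lim_left_div _ _ tB (xin - xi1) (xin - xi1)).
    + apply Rgt_not_eq. rewrite Hx. exact Hc.
    + apply lim_left_minus; [exact scaled_lam_n|exact scaled_lam_1].
    + apply lim_left_minus; [exact (scaled_lam_high i Hi)|exact scaled_lam_1].
  - rewrite Hone. ring.
Qed.

(** * The product of all u_i up to a convergent factor *)

Local Notation gamma := ((- p * INR J + q * INR (n - J)) / (p - q)).
Local Notation beta_sum := (sum_n_m (fun i => step J 0 (ln (beta i)) i) 1 n).
Local Notation Main t := (INR J * Lam 1%nat t + INR (n - J) * Lam n t).

Lemma sum_xi : sum_n_m (fun i => xi i) 1 n = gamma :> R.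
Proof. rewrite sum_1_step by lia. field. lra. Qed.

Lemma Lam_low i t : (1 <= i <= J)%nat -> 0 < t < tB -> Lam i t = Lam 1%nat t.
Proof.
  intros Hi Ht.
  assert (H : Lam i t + - Lam 1%nat t = 0); [|lra].
  apply (conserved_of_right_limit (fun t => Lam i t + - Lam 1%nat t) tB); [| |exact Ht].
  - replace (locally 0) with (locally (0 + - 0)) by (f_equal; ring).
    apply (filterlim_comp_2 (F := at_right 0) (Lam i) (fun t => - Lam 1%nat t) Rplus (H := locally (- 0))
      (Lam_right_0 i ltac:(lia))).
    + apply (filterlim_comp _ _ _ (Lam 1%nat) Ropp _ _ _ (Lam_right_0 1 one_le_n) (filterlim_opp 0)).
    + apply (filterlim_plus 0 (- 0)).
  - intros y Hy. rewrite <- (Rminus_diag (lam 1%nat y)).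
    rewrite <- (lam_low i y Hi Hy) at 1.
    exact (is_derive_minus _ _ y _ _ (Lam_derive i y ltac:(lia) Hy) (Lam_derive 1 y one_le_n Hy)).
Qed.

(** The product of the u_i is u_1^J u_n^(n-J) up to a factor with a positive limit; this makes [rho]
    explicit in u_1 and u_n. *)
Lemma sum_Lam_lim : lim_left (fun t => Sum Lam t - Main t) tB beta_sum.
Proof.
  apply lim_left_ext with
    (fun t => sum_n_m (fun i => Lam i t - step J (Lam 1%nat t) (Lam n t) i) 1 n).
  - apply filter_forall. intros t.
    rewrite (sum_1_minus (fun i => Lam i t)), sum_1_step by lia. reflexivity.
  - apply (lim_left_sum
      (fun i t => Lam i t - step J (Lam 1%nat t) (Lam n t) i)).
    intros i Hi. unfold step. destruct (le_lt_dec i J) as [HiJ|HiJ].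
    + apply lim_left_ext with (fun _ => 0); [|apply lim_left_const].
      apply near_tB. intros t Ht. rewrite (Lam_low i t); [ring|lia|exact Ht].
    + apply Lam_ratio_lim. lia.
Qed.

Local Notation Corr t := (exp (- (Sum Lam t - Main t))).

Lemma Corr_lim : lim_left (fun t => Corr t) tB (exp (- beta_sum)).
Proof.
  apply (lim_left_comp exp).
  - apply (ex_derive_continuous exp). auto_derive. exact I.
  - apply lim_left_opp, sum_Lam_lim.
Qed.

Lemma rho_factor t : 0 < t < tB -> rho t = rho0 * exp (- Main t) * Corr t.
Proof.
  intros Ht. rewrite rho_eq by exact Ht. rewrite Rmult_assoc, <- exp_plus.
  f_equal. f_equal. ring.
Qed.

Lemma scaled_sum_lam : lim_left (fun t => (tB - t) * Sum lam t) tB gamma.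
Proof.
  rewrite <- sum_xi.
  apply lim_left_ext with (fun t => sum_n_m (fun i => (tB - t) * lam i t) 1 n).
  - apply filter_forall. intros t. apply (sum_1_scal (tB - t) (fun i => lam i t)).
  - apply (lim_left_sum (fun i t => (tB - t) * lam i t)). intros i Hi. apply scaled_lam, Hi.
Qed.

(** * The equations for theta and mu, and the range of gamma *)

Local Notation kn := (k / INR n).

Lemma kn_pos : 0 < kn.
Proof. apply Rdiv_lt_0_compat; [exact Hk|exact INR_n_pos]. Qed.

(** The logarithm of theta = (k/n) s^2 rho. *)
Local Notation psi t := (ln (kn * rho0) + 2 * ln (tB - t) - Sum Lam t).

Lemma exp_psi t : 0 < t < tB -> exp (psi t) = kn * ((tB - t) ^ 2 * rho t).
Proof.
  intros Ht. rewrite rho_eq by exact Ht.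
  unfold Rminus. rewrite !exp_plus.
  replace (2 * ln (tB + - t)) with (ln (tB + - t) + ln (tB + - t)) by ring.
  rewrite exp_plus, !exp_ln.
  - ring.
  - lra.
  - pose proof kn_pos. apply Rmult_lt_0_compat; assumption.
Qed.

Lemma psi_derive t : 0 < t < tB ->
  is_derive (fun t => psi t) t ((- 2 - (tB - t) * Sum lam t) / (tB - t)).
Proof.
  intros Ht. pose proof (sum_Lam_derive t Ht) as D.
  set (S := fun t => Sum Lam t) in *.
  change (is_derive (fun t => ln (kn * rho0) + 2 * ln (tB - t) - S t) t
    ((- 2 - (tB - t) * Sum lam t) / (tB - t))).
  auto_derive.
  - repeat split; [lra|eexists; exact D].
  - replace (Derive (fun x => S x) t) with (Sum lam t) by (symmetry; apply is_derive_unique, D).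
    field. lra.
Qed.

Local Notation mu t := ((tB - t) * lam 1%nat t).
Local Notation rest t := (- mu t - mu t * mu t - kn * cb * ((tB - t) * (tB - t))).

Lemma mu_derive t : 0 < t < tB ->
  is_derive (fun t => mu t) t ((exp (psi t) + rest t) / (tB - t)).
Proof.
  intros Ht. rewrite exp_psi by exact Ht.
  pose proof (lam_derive 1 t one_le_n Ht) as D.
  auto_derive.
  - repeat split. eexists; exact D.
  - replace (Derive (fun x => lam 1%nat x) t) with (- lam 1%nat t ^ 2 + kn * (rho t - cb))
      by (symmetry; apply is_derive_unique, D).
    field. repeat split; first [lra | apply Rgt_not_eq, INR_n_pos].
Qed.

Lemma rest_lim : lim_left (fun t => rest t) tB (- (xi1 ^ 2 + xi1)).
Proof.
  replace (- (xi1 ^ 2 + xi1)) with (- xi1 - xi1 * xi1 - kn * cb * (0 * 0)) by ring.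
  apply lim_left_minus; [apply lim_left_minus|].
  - apply lim_left_opp, scaled_lam_1.
  - apply lim_left_mult; exact scaled_lam_1.
  - apply lim_left_mult; [apply lim_left_const|]. apply lim_left_mult; apply lim_left_remaining.
Qed.

Lemma psi_exponent_lim : lim_left (fun t => - 2 - (tB - t) * Sum lam t) tB (- 2 - gamma).
Proof. apply lim_left_minus; [apply lim_left_const|exact scaled_sum_lam]. Qed.

(* [mu] converges, so [(tB - t) mu' = exp psi + rest] cannot stay away from zero. *)
Lemma criticality :
  (- 2 < gamma /\ xi1 ^ 2 + xi1 = 0) \/
  (gamma = - 2 /\ lim_left (fun t => exp (psi t)) tB (xi1 ^ 2 + xi1)).
Proof.
  assert (Hmu : at_left tB (fun t => is_derive (fun t => mu t) t ((exp (psi t) + rest t) / (tB - t)))).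
  { apply near_tB. exact mu_derive. }
  assert (Hpsi : at_left tB (fun t =>
    is_derive (fun t => psi t) t ((- 2 - (tB - t) * Sum lam t) / (tB - t)))).
  { apply near_tB. exact psi_derive. }
  destruct (Rtotal_order gamma (- 2)) as [H|[H|H]].
  (* If gamma < -2, [psi] tends to infinity and eventually the scaled derivative of [mu] exceeds 1,
     so [mu] diverges. *)
  - exfalso.
    assert (Hinf : lim_left_pinfty (fun t => psi t) tB).
    { apply (log_derivative_pinfty _ _ tB ((- 2 - gamma) / 2) ltac:(lra) Hpsi).
      generalize (at_left_and (at_left_gt 0 tB HtB)
        (lim_left_gt _ _ _ ((- 2 - gamma) / 2) psi_exponent_lim ltac:(lra))).
      apply filter_imp. intros t [Ht Hg]. left.
      replace ((tB - t) * ((- 2 - (tB - t) * Sum lam t) / (tB - t)))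
        with (- 2 - (tB - t) * Sum lam t) by (field; lra). exact Hg. }
    apply (lim_left_pinfty_not_finite (fun t => mu t) tB xi1); [|exact scaled_lam_1].
    apply (log_derivative_pinfty _ _ tB 1 Rlt_0_1 Hmu).
    (* Since exp (psi) >= 1 + psi, the bound psi > c outweighs the negative lower bound of [rest] by
       more than 1. *)
    set (c := 1 + (xi1 ^ 2 + xi1) + 1).
    generalize (at_left_and (at_left_gt 0 tB HtB) (at_left_and
      (lim_left_gt _ _ _ (- (xi1 ^ 2 + xi1) - 1) rest_lim ltac:(lra))
      (proj1 (lim_left_pinfty_iff _ _) Hinf c))).
    apply filter_imp. intros t [Ht [H1 H2]].
    replace ((tB - t) * ((exp (psi t) + rest t) / (tB - t))) with (exp (psi t) + rest t)
      by (field; repeat split; first [lra | apply Rgt_not_eq, INR_n_pos]).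
    pose proof (exp_ineq1_le (psi t)). unfold c in H2. lra.
  - right. split; [exact H|].
    apply (slowly_varying_tauberian (fun t => mu t) (fun t => psi t)
      (fun t => - 2 - (tB - t) * Sum lam t) (fun t => rest t) tB xi1).
    + exact scaled_lam_1.
    + exact rest_lim.
    + replace 0 with (- 2 - gamma) by lra. exact psi_exponent_lim.
    + exact Hmu.
    + exact Hpsi.
  - left. split; [exact H|].
    (* For gamma > -2 theta tends to 0, so s mu' tends to -(xi1^2 + xi1); convergence of [mu] forces
       this limit to be 0. *)
    assert (Hexp : lim_left (fun t => exp (psi t)) tB 0).
    { apply lim_left_ext with (fun t => exp (- - psi t)).
      { apply filter_forall. intros t. rewrite Ropp_involutive. reflexivity. }
      apply lim_left_exp_opp_pinfty.
      apply (log_derivative_pinfty _ (fun t => - ((- 2 - (tB - t) * Sum lam t) / (tB - t))) tB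
        ((2 + gamma) / 2) ltac:(lra)).
      - revert Hpsi. apply filter_imp. intros t Ht. exact (is_derive_opp _ t _ Ht).
      - generalize (at_left_and (at_left_gt 0 tB HtB)
          (lim_left_lt _ _ _ (- ((2 + gamma) / 2)) psi_exponent_lim ltac:(lra))).
        apply filter_imp. intros t [Ht Hg].
        replace ((tB - t) * - ((- 2 - (tB - t) * Sum lam t) / (tB - t)))
          with (- (- 2 - (tB - t) * Sum lam t)) by (field; lra). lra. }
    assert (H0 : 0 + - (xi1 ^ 2 + xi1) = 0); [|lra].
    apply (log_derivative_lim_zero (fun t => mu t) _ tB xi1 _ Hmu scaled_lam_1).
    apply lim_left_ext with (fun t => exp (psi t) + rest t).
    + apply near_tB. intros t Ht. field. repeat split; first [lra | apply Rgt_not_eq, INR_n_pos].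
    + apply lim_left_plus; [exact Hexp|exact rest_lim].
Qed.

(* [u_n] is eventually convex because [rho] tends to infinity, hence has slope at least [- C];
   as [u_n] is large compared with [(C + 1) (tB - t)], it cannot reach zero at [tB]. *)
Lemma Lam_n_bounded_below : q = 0 ->
  exists m C, at_left tB (fun t => m <= Lam n t /\ - C <= lam n t).
Proof.
  intros Hq0. pose proof kn_pos as Hkn.
  assert (HJ1 : 1 <= INR J) by (apply (le_INR 1); lia).
  assert (Hg : gamma = - INR J) by (rewrite Hq0; field; lra).
  (* With q = 0, gamma = -J <= -1, so the product of the u_i tends to 0. *)
  assert (Hrho : lim_left_pinfty (fun t => - Sum Lam t) tB).
  { apply (log_derivative_pinfty _ (fun t => - Sum lam t) tB (1 / 2)); [lra| |].
    - apply near_tB. intros t Ht. exact (is_derive_opp _ t _ (sum_Lam_derive t Ht)).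
    - generalize (lim_left_lt _ _ _ (- (1 / 2)) scaled_sum_lam ltac:(lra)).
      apply filter_imp. intros t Ht. lra. }
  (* The inequality exp x >= 1 + x turns the threshold [cb / rho0] into rho >= cb. *)
  destruct (proj1 (at_left_iff _ _) (at_left_and (at_left_gt 0 tB HtB)
    (proj1 (lim_left_pinfty_iff _ _) Hrho (cb / rho0)))) as [a [Ha Hcb]].
  set (t0 := (a + tB) / 2). assert (Ht0 : a < t0 < tB) by (unfold t0; lra).
  assert (Hrhocb : forall t, a < t < tB -> 0 < t /\ cb <= rho t).
  { intros t Ht. destruct (Hcb t Ht) as [Ht' H]. split; [lra|].
    rewrite rho_eq by exact Ht'. pose proof (exp_ineq1_le (- Sum Lam t)).
    apply Rmult_le_reg_l with (/ rho0); [apply Rinv_0_lt_compat, Hrho0|].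
    rewrite <- Rmult_assoc, Rinv_l by lra. unfold Rdiv in H. lra. }
  assert (HD : forall t, a < t < tB ->
    is_derive (fun t => exp (Lam n t)) t (lam n t * exp (Lam n t)) /\
    is_derive (fun t => lam n t * exp (Lam n t)) t (kn * (rho t - cb) * exp (Lam n t))).
  { intros t Ht. destruct (Hrhocb t Ht) as [Htp _].
    pose proof (Lam_derive n t n_le_n ltac:(lra)) as D1.
    pose proof (lam_derive n t n_le_n ltac:(lra)) as D2.
    split; auto_derive.
    - repeat split. eexists; exact D1.
    - replace (Derive (fun x => Lam n x) t) with (lam n t) by (symmetry; apply is_derive_unique, D1).
      ring.
    - repeat split; eexists; eassumption.
    - replace (Derive (fun x => Lam n x) t) with (lam n t) by (symmetry; apply is_derive_unique, D1).
      replace (Derive (fun x => lam n x) t) with (- lam n t ^ 2 + kn * (rho t - cb))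
        by (symmetry; apply is_derive_unique, D2).
      ring. }
  set (C := Rabs (lam n t0 * exp (Lam n t0))).
  assert (HC : 0 <= C) by apply Rabs_pos.
  (* Here u_n'' = kn (rho - cb) u_n >= 0, so u_n' does not fall below its value at [t0]. *)
  assert (Hv : forall t, t0 <= t < tB -> - C <= lam n t * exp (Lam n t)).
  { intros t Ht. apply Rle_trans with (lam n t0 * exp (Lam n t0)).
    - unfold C. pose proof (Rle_abs (- (lam n t0 * exp (Lam n t0)))) as H.
      rewrite Rabs_Ropp in H. lra.
    - apply (derive_nonneg_le (fun t => lam n t * exp (Lam n t))
        (fun t => kn * (rho t - cb) * exp (Lam n t))); [lra| |].
      + intros x Hx. apply HD. lra.
      + intros x Hx. destruct (Hrhocb x) as [_ H]; [lra|].
        apply Rmult_le_pos; [apply Rmult_le_pos; lra|left; apply exp_pos]. }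
  (* As s lambda_n tends to 0, the logarithm of u_n / s has scaled derivative tending to 1, so u_n /
     s tends to infinity. *)
  assert (Hlarge : lim_left_pinfty (fun t => Lam n t - ln (tB - t)) tB).
  { apply (log_derivative_pinfty _ (fun t => lam n t + / (tB - t)) tB (1 / 2)); [lra| |].
    - apply near_tB. intros t Ht. pose proof (Lam_derive n t n_le_n Ht) as D.
      auto_derive.
      + repeat split; [eexists; exact D|lra].
      + replace (Derive (fun x => Lam n x) t) with (lam n t)
          by (symmetry; apply is_derive_unique, D).
        field. lra.
    - generalize (at_left_and (at_left_gt 0 tB HtB) (lim_left_gt _ _ _ (- (1 / 2)) scaled_lam_n
        ltac:(replace xin with 0 by (rewrite Hq0; field; lra); lra))).
      apply filter_imp. intros t [Ht H].
      replace ((tB - t) * (lam n t + / (tB - t))) with ((tB - t) * lam n t + 1) by (field; lra).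
      lra. }
  (* At [t1] the value of u_n is at least C + 1 times the remaining time, and a slope of at least -C
     can consume only C of these parts. *)
  destruct (at_left_ex (at_left_and (at_left_gt t0 tB (proj2 Ht0))
    (proj1 (lim_left_pinfty_iff _ _) Hlarge (ln (C + 1))))) as [t1 [Ht1 Hbig]].
  assert (Hu1 : (C + 1) * (tB - t1) <= exp (Lam n t1)).
  { left. rewrite <- (exp_ln ((C + 1) * (tB - t1))) by (apply Rmult_lt_0_compat; lra).
    apply exp_increasing. rewrite ln_mult by lra. lra. }
  assert (Hu : forall t, t1 <= t < tB -> tB - t1 <= exp (Lam n t)).
  { intros t Ht.
    assert (H : exp (Lam n t1) + C * t1 <= exp (Lam n t) + C * t).
    { apply (derive_nonneg_le (fun t => exp (Lam n t) + C * t)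
        (fun t => lam n t * exp (Lam n t) + C)); [lra| |].
      - intros x Hx. apply (is_derive_plus (fun t => exp (Lam n t)) (fun t => C * t)).
        + apply HD. lra.
        + auto_derive; [exact I|ring].
      - intros x Hx. pose proof (Hv x ltac:(lra)). lra. }
    pose proof (Rmult_le_compat_l C (t - t1) (tB - t1) HC ltac:(lra)). lra. }
  (* The second bound comes from lambda_n = u_n' / u_n with u_n' >= -C and u_n >= tB - t1. *)
  exists (ln (tB - t1)), (C / (tB - t1)).
  generalize (at_left_gt t1 tB (proj2 Ht1)). apply filter_imp. intros t Ht.
  pose proof (Hu t ltac:(lra)) as Hut. pose proof (Hv t ltac:(lra)) as Hvt. split.
  - rewrite <- (ln_exp (Lam n t)). apply ln_le; lra.
  - apply Rnot_lt_le. intros Hlt.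
    assert (H1 : C < - lam n t * (tB - t1)).
    { apply Rmult_lt_reg_r with (/ (tB - t1)); [apply Rinv_0_lt_compat; lra|].
      rewrite Rmult_assoc, Rinv_r by lra. unfold Rdiv in Hlt. lra. }
    assert (H2 : 0 < - lam n t).
    { apply Rnot_le_lt. intros Hle. pose proof (Rmult_le_compat_r (tB - t1) _ _ ltac:(lra) Hle). lra. }
    pose proof (Rmult_le_compat_l (- lam n t) _ _ ltac:(lra) Hut). lra.
Qed.

(** * The remainders and the integral of their sum *)

Local Notation Rf i t := (lam i t - xi i / (tB - t)).
Local Notation Rsum t := (sum_n_m (fun i => Rf i t) 1 n).

Lemma scaled_Rf i : (1 <= i <= n)%nat -> lim_left (fun t => (tB - t) * Rf i t) tB 0.
Proof.
  intros Hi. apply lim_left_ext with (fun t => (tB - t) * lam i t - xi i).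
  - apply near_tB. intros t Ht. field. lra.
  - rewrite <- (Rminus_diag (xi i)).
    apply lim_left_minus; [exact (scaled_lam i Hi)|apply lim_left_const].
Qed.

Lemma sum_lam_decomposition t : Sum lam t = gamma / (tB - t) + Rsum t :> R.
Proof.
  rewrite (sum_1_minus (fun i => lam i t)).
  rewrite (sum_n_m_ext (fun i => xi i / (tB - t)) (fun i => / (tB - t) * xi i))
    by (intros; apply Rmult_comm).
  rewrite (sum_1_scal (/ (tB - t)) (fun i => xi i)), sum_xi.
  symmetry. unfold Rdiv. ring.
Qed.

Lemma is_RInt_sum_1 (f : nat -> R -> R) (I : nat -> R) (a b : R) (m : nat) :
  (forall i, (1 <= i <= m)%nat -> is_RInt (f i) a b (I i)) ->
  is_RInt (fun t => sum_n_m (fun i => f i t) 1 m) a b (sum_n_m I 1 m).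
Proof.
  induction m as [|m IH]; intros H.
  - rewrite sum_1_0. apply is_RInt_ext with (fun _ => 0).
    + intros x _. rewrite sum_1_0. reflexivity.
    + evar_last; [exact (is_RInt_const a b 0)|apply Rmult_0_r].
  - rewrite sum_1_S. apply is_RInt_ext with (fun t => sum_n_m (fun i => f i t) 1 m + f (S m) t).
    + intros x _. rewrite sum_1_S. reflexivity.
    + apply (is_RInt_plus (fun t => sum_n_m (fun i => f i t) 1 m) (f (S m)));
        [apply IH; intros; apply H; lia|apply H; lia].
Qed.

Lemma RInt_Rsum t : 0 <= t < tB ->
  RInt (fun t => Rsum t) 0 t = Sum Lam t + gamma * ln ((tB - t) / tB).
Proof.
  intros Ht. apply is_RInt_unique.
  replace (Sum Lam t + gamma * ln ((tB - t) / tB))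
    with (sum_n_m (fun i => Lam i t - (- ln ((tB - t) / tB)) * xi i) 1 n).
  - apply (is_RInt_sum_1 (fun i t => Rf i t)). intros i Hi.
    apply (is_RInt_minus (lam i) (fun t => xi i / (tB - t)) 0 t (Lam i t)).
    { apply lam_is_RInt; assumption. }
    set (x := xi i).
    replace (- ln ((tB - t) / tB) * x) with ((- x * ln (tB - t)) - (- x * ln (tB - 0)))
      by (rewrite ln_div, Rminus_0_r by lra; ring).
    apply (is_RInt_derive (fun t => - x * ln (tB - t)) (fun t => x / (tB - t))).
    + intros y Hy. rewrite Rmin_left, Rmax_right in Hy by lra.
      auto_derive; [lra|field; lra].
    + intros y Hy. rewrite Rmin_left, Rmax_right in Hy by lra.
      apply (ex_derive_continuous (fun t => x / (tB - t))). auto_derive. lra.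
  - rewrite (sum_1_minus (fun i => Lam i t)), (sum_1_scal (- ln ((tB - t) / tB)) (fun i => xi i)),
      sum_xi.
    match goal with |- ?a = ?b => change (@eq R a b) end. ring.
Qed.

(** For gamma = -2 the singular part contributes exactly (s / tB)^2, so this exponential is theta up
    to a constant; hence the tB^2 in the quadratic equations. *)
Lemma exp_opp_RInt_Rsum t : gamma = - 2 -> 0 < t < tB ->
  exp (- RInt (fun t => Rsum t) 0 t) = exp (psi t) / (kn * rho0 * tB ^ 2).
Proof.
  intros Hg Ht. rewrite RInt_Rsum by lra. rewrite Hg. pose proof kn_pos as Hkn.
  assert (H : kn * rho0 * tB ^ 2 = exp (ln (kn * rho0) + (ln tB + ln tB))).
  { rewrite !exp_plus, !exp_ln; [ring|exact HtB|apply Rmult_lt_0_compat; assumption]. }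
  rewrite H. unfold Rdiv. rewrite <- exp_Ropp, <- exp_plus. f_equal.
  change ((tB - t) * / tB) with ((tB - t) / tB). rewrite ln_div by lra. ring.
Qed.

Lemma exp_opp_RInt_Rsum_lim E : gamma = - 2 -> lim_left (fun t => exp (psi t)) tB E ->
  lim_left (fun t => exp (- RInt (fun t => Rsum t) 0 t)) tB (E / (kn * rho0 * tB ^ 2)).
Proof.
  intros Hg HE. apply lim_left_ext with (fun t => exp (psi t) / (kn * rho0 * tB ^ 2)).
  - apply near_tB. intros t Ht. symmetry. apply exp_opp_RInt_Rsum; assumption.
  - apply lim_left_mult; [exact HE|apply lim_left_const].
Qed.

(** * Growth of the density compared with s^(-2) *)

Lemma scaled_rho_lim E : lim_left (fun t => exp (psi t)) tB E ->
  lim_left (fun t => (tB - t) ^ 2 * rho t) tB (/ kn * E).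
Proof.
  intros HE. pose proof kn_pos.
  apply lim_left_ext with (fun t => / kn * exp (psi t)).
  - apply near_tB. intros t Ht. rewrite exp_psi by exact Ht.
    rewrite <- Rmult_assoc, Rinv_l, Rmult_1_l by lra. reflexivity.
  - apply lim_left_mult; [apply lim_left_const|exact HE].
Qed.

Lemma bigO_left_of_near f g (M : R) : 0 < M ->
  at_left tB (fun t => Rabs (f t) <= M * Rabs (g t)) -> bigO_left tB f g.
Proof.
  intros HM H. destruct (proj1 (at_left_iff _ _) H) as [a [Ha Hfg]].
  exists M, (tB - a). repeat split; [exact HM|lra|]. intros t Ht. apply Hfg. lra.
Qed.

Lemma Rabs_le_of_scaled x c s : 0 < s -> Rabs (s ^ 2 * x) <= c -> Rabs x <= c * Rabs (1 / s ^ 2).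
Proof.
  intros Hs H. assert (Hs2 : 0 < s ^ 2) by (apply pow_lt, Hs).
  rewrite Rabs_mult, (Rabs_pos_eq (s ^ 2)) in H by lra.
  rewrite (Rabs_pos_eq (1 / _)) by (apply Rlt_le, Rdiv_lt_0_compat; lra).
  apply Rmult_le_reg_l with (s ^ 2); [exact Hs2|].
  replace (s ^ 2 * (c * (1 / s ^ 2))) with c by (field; lra). exact H.
Qed.

Lemma rho_bigO_inv_square E : lim_left (fun t => exp (psi t)) tB E ->
  bigO_left tB rho (fun t => 1 / (tB - t) ^ 2).
Proof.
  intros HE. pose proof (scaled_rho_lim E HE) as H. set (l := / kn * E) in *.
  pose proof (Rabs_pos l).
  apply bigO_left_of_near with (Rabs l + 1); [lra|].
  generalize (at_left_and (at_left_gt 0 tB HtB) (proj1 (lim_left_iff _ _ _) H 1 Rlt_0_1)).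
  apply filter_imp. intros t [Ht Hl]. apply Rabs_le_of_scaled; [lra|].
  replace ((tB - t) ^ 2 * rho t) with (l + ((tB - t) ^ 2 * rho t - l)) by ring.
  eapply Rle_trans; [apply Rabs_triang|]. lra.
Qed.

Lemma rho_littleo_inv_square : lim_left (fun t => exp (psi t)) tB 0 ->
  littleo_left tB rho (fun t => 1 / (tB - t) ^ 2).
Proof.
  intros HE eps Heps. pose proof (scaled_rho_lim 0 HE) as H. rewrite Rmult_0_r in H.
  destruct (proj1 (at_left_iff _ _) (at_left_and (at_left_gt 0 tB HtB)
    (proj1 (lim_left_iff _ _ _) H eps Heps))) as [a [Ha Hs]].
  exists (tB - a). split; [lra|]. intros t Ht. destruct (Hs t ltac:(lra)) as [Ht0 Hl].
  rewrite Rminus_0_r in Hl. apply Rabs_le_of_scaled; lra.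
Qed.

(** * Arithmetic of the exponents *)

Lemma xi1_quadratic : xi1 ^ 2 + xi1 = p * q / (p - q) ^ 2.
Proof. field. lra. Qed.

Lemma xin_quadratic : xin ^ 2 + xin = p * q / (p - q) ^ 2.
Proof. field. lra. Qed.

Lemma quadratic_zero : p * q / (p - q) ^ 2 = 0 -> q = 0.
Proof.
  intros H. assert (H1 : p * q = 0).
  { replace (p * q) with (p * q / (p - q) ^ 2 * (p - q) ^ 2) by (field; lra). rewrite H. ring. }
  apply Rmult_integral in H1. lra.
Qed.

Lemma quadratic_at_zero : q = 0 -> p * q / (p - q) ^ 2 = 0.
Proof. intros ->. unfold Rdiv. ring. Qed.

Lemma subcritical_J : - 2 < gamma -> q = 0 -> J = 1%nat.
Proof.
  intros Hg Hq0. assert (H : gamma = - INR J) by (rewrite Hq0; field; lra).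
  assert (H2 : INR J < INR 2) by (simpl; lra). apply INR_lt in H2. lia.
Qed.

Lemma INR_n_minus_J : INR (n - J) = INR n - INR J.
Proof. apply minus_INR. lia. Qed.

(** For q > 0 this excludes J = 1, turns J = 2 into n = 4, and turns J >= 3 into n > 2 J. *)
Lemma critical_identity : gamma = - 2 -> p * (INR J - 2) = q * (INR n - INR J - 2).
Proof.
  intros Hg. rewrite INR_n_minus_J in Hg.
  assert (H : - p * INR J + q * (INR n - INR J) = - 2 * (p - q)).
  { rewrite <- Hg. field. lra. }
  lra.
Qed.

(** Carries divergence of u_n over to every u_i with i > J. *)
Lemma Lam_ge_Lam_n i t : (J < i <= n)%nat -> 0 < t < tB -> Lam n t + ln (beta i) <= Lam i t.
Proof.
  intros Hi Ht. pose proof (beta_pos i Hi) as Hb.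
  pose proof (ln_le _ _ Hb (exp_Lam_ratio_ge i t Hi Ht)) as H. rewrite ln_exp in H. lra.
Qed.

(** * Bounds for J = 1 and q = 0 *)

Lemma subcritical_rho_bigO : J = 1%nat -> q = 0 -> bigO_left tB rho (fun t => 1 / (tB - t)).
Proof.
  intros HJ1 Hq0. destruct (Lam_n_bounded_below Hq0) as [m [C Hm]].
  pose proof J_lt_n as HJn.
  (* For J = 1 the leading product splits as u_1 u_n^(n-1) = (u_1 u_n) u_n^(n-2). *)
  set (N := INR (n - 2)). assert (HN : 0 <= N) by apply pos_INR.
  set (a := / (p - q) + 1). set (b := exp (- beta_sum) + 1).
  assert (Ha : 0 < a) by (unfold a; pose proof (Rinv_0_lt_compat (p - q) ltac:(lra)); lra).
  assert (Hb : 0 < b) by (unfold b; pose proof (exp_pos (- beta_sum)); lra).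
  pose proof (exp_pos (- (N * m))) as He.
  apply bigO_left_of_near with (rho0 * (a * (exp (- (N * m)) * b))).
  { repeat apply Rmult_lt_0_compat; assumption. }
  generalize (at_left_and (at_left_gt 0 tB HtB) (at_left_and Hm (at_left_and
    (lim_left_lt _ _ _ a remaining_over_Prod ltac:(unfold a; lra))
    (lim_left_lt _ _ _ b Corr_lim ltac:(unfold b; lra))))).
  apply filter_imp. intros t [Ht [[Hmt _] [Hat Hbt]]].
  (* All factors before 1/s are bounded: two converge, and the negative power of u_n is bounded
     since u_n stays away from 0. *)
  assert (Hrho : rho t = rho0 * ((tB - t) / Prod t * (exp (- (N * Lam n t)) * Corr t)) * (1 / (tB - t))).
  { rewrite rho_factor by exact Ht.
    replace (- Main t) with (- (Lam 1%nat t + Lam n t) + - (N * Lam n t)).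
    - rewrite (exp_plus (- (Lam 1%nat t + Lam n t))), (exp_Ropp (Lam 1%nat t + Lam n t)).
      field. split; [lra|apply Rgt_not_eq, exp_pos].
    - unfold N. rewrite HJ1. replace (n - 1)%nat with (S (n - 2)) by lia.
      rewrite (S_INR (n - 2)). simpl (INR 1). ring. }
  assert (Hs : 0 < 1 / (tB - t)) by (apply Rdiv_lt_0_compat; lra).
  assert (Hpos1 : 0 < (tB - t) / Prod t) by (apply Rdiv_lt_0_compat; [lra|apply exp_pos]).
  pose proof (exp_pos (- (N * Lam n t))) as Hpos2.
  pose proof (exp_pos (- (Sum Lam t - Main t))) as Hpos3.
  rewrite Hrho. rewrite Rabs_mult. apply Rmult_le_compat_r; [apply Rabs_pos|].
  assert (Hy : exp (- (N * Lam n t)) <= exp (- (N * m))).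
  { apply exp_le. pose proof (Rmult_le_compat_l N _ _ HN Hmt). lra. }
  set (x := (tB - t) / Prod t) in *. set (y := exp (- (N * Lam n t))) in *.
  set (z := Corr t) in *. clearbody x y z.
  rewrite Rabs_pos_eq by (repeat apply Rmult_le_pos; lra).
  apply Rmult_le_compat_l; [lra|].
  apply Rmult_le_compat; [lra| |lra|].
  - apply Rmult_le_pos; lra.
  - apply Rmult_le_compat; lra.
Qed.

(** From above, lambda_n' <= O(1/s) integrates to a logarithm; from below, lambda_n is bounded. The
    other lambda_i differ from lambda_n by a bounded amount. *)
Lemma subcritical_lam_bigO i : J = 1%nat -> q = 0 -> (2 <= i <= n)%nat ->
  bigO_left tB (lam i) (fun t => Rabs (ln (tB - t))).
Proof.
  intros HJ1 Hq0 Hi. pose proof kn_pos as Hkn. pose proof J_lt_n as HJn.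
  assert (HJi : (J < i <= n)%nat) by lia.
  destruct (Lam_n_bounded_below Hq0) as [m [C0 Hm]].
  destruct (subcritical_rho_bigO HJ1 Hq0) as [M [d [HM [Hd HrhoM]]]].
  set (D := kn * M). assert (HD : 0 < D) by (apply Rmult_lt_0_compat; assumption).
  assert (Hcb0 : 0 <= Rabs cb) by apply Rabs_pos.
  destruct (proj1 (at_left_iff _ _) (at_left_and (at_left_gt 0 tB HtB) (at_left_and Hm
    (at_left_gt (tB - d) tB ltac:(lra))))) as [a [Ha Hall]].
  set (t0 := (a + tB) / 2). assert (Ht0 : a < t0 < tB) by (unfold t0; lra).
  set (C1 := Rabs (lam n t0 + D * ln (tB - t0) - kn * Rabs cb * t0)).
  assert (Hup : forall t, t0 <= t < tB -> lam n t <= C1 + kn * Rabs cb * tB - D * ln (tB - t)).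
  { intros t Ht.
    (* lambda_n + D ln s - kn |cb| t is nonincreasing: D / s absorbs kn rho, kn |cb| absorbs -kn cb,
       and -lambda_n^2 has the right sign. *)
    assert (H : - (lam n t0 + D * ln (tB - t0) - kn * Rabs cb * t0)
                <= - (lam n t + D * ln (tB - t) - kn * Rabs cb * t)).
    { apply (derive_nonneg_le (fun t => - (lam n t + D * ln (tB - t) - kn * Rabs cb * t))
        (fun t => lam n t ^ 2 + (D / (tB - t) - kn * rho t) + kn * (Rabs cb + cb))); [lra| |].
      - intros x Hx. destruct (Hall x ltac:(lra)) as [Hx0 _].
        pose proof (lam_derive n x n_le_n Hx0) as DX. auto_derive.
        + repeat split; [eexists; exact DX|lra].
        + replace (Derive (fun x => lam n x) x) with (- lam n x ^ 2 + kn * (rho x - cb))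
            by (symmetry; apply is_derive_unique, DX).
          field. repeat split; first [lra | apply Rgt_not_eq, INR_n_pos].
      - intros x Hx. destruct (Hall x ltac:(lra)) as [Hx0 [_ Hxd]].
        assert (H1 : kn * rho x <= D / (tB - x)).
        { unfold D, Rdiv at 2. rewrite Rmult_assoc. apply Rmult_le_compat_l; [lra|].
          pose proof (HrhoM x ltac:(lra)) as H1.
          rewrite (Rabs_pos_eq (1 / _)) in H1 by (apply Rlt_le, Rdiv_lt_0_compat; lra).
          pose proof (Rle_abs (rho x)). unfold Rdiv in H1. lra. }
        assert (H2 : 0 <= kn * (Rabs cb + cb)).
        { apply Rmult_le_pos; [lra|]. pose proof (Rle_abs (- cb)) as H2.
          rewrite Rabs_Ropp in H2. lra. }
        pose proof (pow2_ge_0 (lam n x)). lra. }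
    assert (H3 : kn * Rabs cb * t <= kn * Rabs cb * tB).
    { apply Rmult_le_compat_l; [apply Rmult_le_pos; lra|lra]. }
    pose proof (Rle_abs (lam n t0 + D * ln (tB - t0) - kn * Rabs cb * t0)). unfold C1. lra. }
  (* Bounds lambda_n - lambda_i once u_n >= exp m. *)
  set (C2 := (lam0 n - lam0 i) / beta i * exp (- (2 * m))).
  set (C := Rabs C0 + Rabs C2 + C1 + kn * Rabs cb * tB).
  assert (HC1 : 0 <= C1) by apply Rabs_pos.
  assert (HkcbtB : 0 <= kn * Rabs cb * tB).
  { apply Rmult_le_pos; [apply Rmult_le_pos|]; lra. }
  assert (HCp : 0 <= C).
  { unfold C. pose proof (Rabs_pos C0). pose proof (Rabs_pos C2). lra. }
  apply bigO_left_of_near with (C + D + 1); [lra|].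
  (* For s < exp (-1) one has |ln s| > 1, so constants can be absorbed into the logarithm. *)
  assert (He1 : tB - exp (- 1) < tB) by (pose proof (exp_pos (- 1)); lra).
  generalize (at_left_and (at_left_gt t0 tB (proj2 Ht0)) (at_left_gt _ tB He1)).
  apply filter_imp. intros t [Ht Ht1].
  destruct (Hall t ltac:(lra)) as [Htp [[Hmt Hlow_n] _]].
  assert (Hln : ln (tB - t) < - 1).
  { rewrite <- (ln_exp (- 1)). apply ln_increasing; lra. }
  rewrite Rabs_Rabsolu, (Rabs_left (ln (tB - t))) by lra.
  pose proof (lam_n_minus_lam i t HJi Htp) as [H1 H2].
  assert (H3 : (lam0 n - lam0 i) / beta i * exp (- (2 * Lam n t)) <= C2).
  { unfold C2. apply Rmult_le_compat_l.
    - pose proof (Hhigh i HJi). pose proof (beta_pos i HJi).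
      apply Rmult_le_pos; [lra|left; apply Rinv_0_lt_compat; assumption].
    - apply exp_le. lra. }
  pose proof (Hup t ltac:(lra)) as H4.
  pose proof (Rle_abs C0). pose proof (Rle_abs C2).
  pose proof (Rabs_pos C0). pose proof (Rabs_pos C2).
  apply Rle_trans with (C - D * ln (tB - t)).
  - assert (HDl : 0 <= D * - ln (tB - t)) by (apply Rmult_le_pos; lra).
    apply Rabs_le. unfold C. lra.
  - assert (HCl : C * 1 <= C * - ln (tB - t)) by (apply Rmult_le_compat_l; lra).
    lra.
Qed.

(** * The case J = 2 *)

Local Notation G t := (kn * rho0 * (((tB - t) / Prod t) * ((tB - t) / Prod t) * Corr t)).

(** For J = 2 one has theta = G u_n^(4-n), because u_1^2 u_n^(n-2) = (u_1 u_n)^2 u_n^(n-4); the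
    convergence of [G] leaves only the power of u_n to study. *)
Lemma G_lim : lim_left (fun t => G t) tB
  (kn * rho0 * (/ (p - q) * / (p - q) * exp (- beta_sum))).
Proof.
  apply lim_left_mult; [apply lim_left_const|].
  apply lim_left_mult; [|exact Corr_lim].
  apply lim_left_mult; exact remaining_over_Prod.
Qed.

Lemma G_lim_pos : 0 < kn * rho0 * (/ (p - q) * / (p - q) * exp (- beta_sum)).
Proof.
  pose proof kn_pos. pose proof (Rinv_0_lt_compat (p - q) ltac:(lra)).
  apply Rmult_lt_0_compat; [apply Rmult_lt_0_compat; assumption|].
  apply Rmult_lt_0_compat; [apply Rmult_lt_0_compat; assumption|apply exp_pos].
Qed.

Lemma exp_psi_J2 t : J = 2%nat -> 0 < t < tB ->
  exp (psi t) = G t * exp (- ((INR n - 4) * Lam n t)).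
Proof.
  intros HJ2 Ht. rewrite exp_psi, rho_factor by exact Ht.
  replace (- Main t) with (- (Lam 1%nat t + Lam n t) + - (Lam 1%nat t + Lam n t)
                           + - ((INR n - 4) * Lam n t)).
  - rewrite !(exp_plus _ (- ((INR n - 4) * Lam n t))),
      (exp_plus (- (Lam 1%nat t + Lam n t))), !(exp_Ropp (Lam 1%nat t + Lam n t)).
    unfold Rdiv. ring.
  - rewrite INR_n_minus_J, HJ2. simpl (INR 2). ring.
Qed.

Lemma critical_J2_power_lim E : J = 2%nat -> lim_left (fun t => exp (psi t)) tB E ->
  lim_left (fun t => exp (- ((INR n - 4) * Lam n t))) tB
    (E / (kn * rho0 * (/ (p - q) * / (p - q) * exp (- beta_sum)))).
Proof.
  intros HJ2 HE.
  apply lim_left_ext with (fun t => exp (psi t) / G t).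
  - apply near_tB. intros t Ht. rewrite exp_psi_J2 by assumption.
    assert (HG : 0 < G t).
    { pose proof kn_pos. assert (Hs : 0 < (tB - t) / Prod t)
        by (apply Rdiv_lt_0_compat; [lra|apply exp_pos]).
      apply Rmult_lt_0_compat; [apply Rmult_lt_0_compat; assumption|].
      apply Rmult_lt_0_compat; [apply Rmult_lt_0_compat; assumption|apply exp_pos]. }
    set (g := G t) in *. field. lra.
  - apply lim_left_div; [|exact HE|exact G_lim].
    apply Rgt_not_eq, G_lim_pos.
Qed.

Lemma critical_degenerate : q = 0 -> gamma = - 2 -> lim_left (fun t => exp (psi t)) tB 0 ->
  J = 2%nat /\ (5 <= n)%nat /\ lim_left_pinfty (Lam n) tB.
Proof.
  intros Hq0 Hg HE. pose proof J_lt_n as HJn.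
  assert (HJ2 : J = 2%nat).
  { assert (H : gamma = - INR J) by (rewrite Hq0; field; lra).
    apply INR_eq. simpl. lra. }
  pose proof (critical_J2_power_lim 0 HJ2 HE) as Hpow.
  unfold Rdiv in Hpow. rewrite Rmult_0_l in Hpow.
  assert (Hn : (n = 3 \/ n = 4 \/ 5 <= n)%nat) by lia.
  split; [exact HJ2|]. destruct Hn as [Hn|[Hn|Hn]].
  (* For n = 3 the power is u_n itself, which would tend to 0 although it is bounded below. *)
  - exfalso. destruct (Lam_n_bounded_below Hq0) as [m [C Hm]].
    assert (Hle : exp m <= 0); [|pose proof (exp_pos m); lra].
    apply (lim_left_ge_bound _ _ _ _ Hpow). revert Hm. apply filter_imp.
    intros t [Hm _].
    replace (- ((INR n - 4) * Lam n t)) with (Lam n t) by (rewrite Hn; simpl; ring).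
    apply exp_le, Hm.
  (* For n = 4 the power is constantly 1. *)
  - exfalso. apply R1_neq_R0. apply (lim_left_unique _ tB) with (2 := Hpow).
    apply lim_left_ext with (fun _ => 1); [|apply lim_left_const].
    apply filter_forall. intros t. rewrite <- exp_0. f_equal. rewrite Hn. simpl. ring.
  (* For n >= 5 the exponent is negative, so the power vanishes only if u_n tends to infinity. *)
  - split; [exact Hn|]. apply lim_left_pinfty_of_exp_opp in Hpow.
    apply lim_left_pinfty_iff. intros M.
    generalize (proj1 (lim_left_pinfty_iff _ _) Hpow ((INR n - 4) * M)).
    apply filter_imp. intros t Ht.
    assert (H5 : 5 <= INR n) by (apply (le_INR 5) in Hn; simpl in Hn; lra).
    apply Rmult_lt_reg_l with (INR n - 4); [lra|exact Ht].
Qed.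

(** For n = 4 theta is exactly [G], whose limit is explicit in the initial data: beta_4 = 1 leaves
    only beta_3, and p + q is the initial gap between lambda_4 and lambda_1. Comparing it with p q /
    (p - q)^2 gives the relation. *)
Lemma critical_J2_amplitude : J = 2%nat -> n = 4%nat ->
  lim_left (fun t => exp (psi t)) tB (p * q / (p - q) ^ 2) ->
  4 * (p * q) * ((lam0 1%nat - lam0 3%nat) * (lam0 1%nat - lam0 4%nat))
    = k * rho0 * (p + q) ^ 2.
Proof.
  intros HJ2 Hn4 HE.
  assert (H : kn * rho0 * (/ (p - q) * / (p - q) * exp (- beta_sum)) = p * q / (p - q) ^ 2).
  { apply (lim_left_unique (fun t => exp (psi t)) tB); [|exact HE].
    apply lim_left_ext with (2 := G_lim). apply near_tB. intros t Ht.
    rewrite exp_psi_J2 by assumption.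
    replace (- ((INR n - 4) * Lam n t)) with 0 by (rewrite Hn4; simpl; ring).
    rewrite exp_0. ring. }
  pose proof wronskian_1n as HW. pose proof (Hhigh 3 ltac:(lia)) as H3.
  pose proof (beta_pos 3 ltac:(lia)) as Hb3.
  assert (Hs : beta_sum = ln (beta 3%nat)).
  { assert (Hb4 : beta 4%nat = 1) by (rewrite <- Hn4; field; lra).
    transitivity (sum_n_m (fun i => step J 0 (ln (beta i)) i) 1 4).
    - exact (f_equal (sum_n_m _ 1) Hn4).
    - rewrite HJ2, !sum_1_S, sum_1_0. unfold step. simpl le_lt_dec. cbv iota.
      rewrite Hb4, ln_1, !Rplus_0_l. apply Rplus_0_r. }
  rewrite Hs, exp_Ropp, exp_ln in H by exact Hb3.
  rewrite <- Hn4 at 1. rewrite <- HW.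
  assert (Hpq0 : p - q <> 0) by lra.
  assert (H4 : INR n = 4) by (rewrite Hn4; simpl; ring).
  rewrite H4 in H.
  assert (H' : k / 4 * rho0 * ((lam0 n - lam0 1%nat) / (lam0 3%nat - lam0 1%nat)) = p * q).
  { replace (p * q) with (p * q / (p - q) ^ 2 * (p - q) ^ 2) by (field; lra).
    rewrite <- H. field. lra. }
  rewrite <- H'. field. lra.
Qed.

Lemma INR_n_eq_4 : n = 4%nat -> INR n = 4.
Proof. intros ->. simpl. ring. Qed.

(** Since (p + q)^2 - 4 p q = (p - q)^2, the amplitude relation reads A0 - k rho0 = A0 ((p - q) / (p
    + q))^2. *)
Lemma critical_J2_scaled_limits : J = 2%nat -> n = 4%nat ->
  lim_left (fun t => exp (psi t)) tB (p * q / (p - q) ^ 2) ->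
  let A0 := (lam0 1%nat - lam0 3%nat) * (lam0 1%nat - lam0 4%nat) in
  k * rho0 < A0 /\ sqrt (A0 / (A0 - k * rho0)) = (p + q) / (p - q).
Proof.
  intros HJ2 Hn4 HE A0.
  pose proof (critical_J2_amplitude HJ2 Hn4 HE) as HA. fold A0 in HA.
  assert (HA0 : 0 < A0).
  { pose proof (Hhigh 3 ltac:(lia)). pose proof (Hhigh 4 ltac:(lia)).
    unfold A0. rewrite <- Rmult_opp_opp. apply Rmult_lt_0_compat; lra. }
  assert (Hsum : 0 < p + q) by lra. assert (Hdiff : 0 < p - q) by lra.
  assert (Hdef : A0 - k * rho0 = A0 * ((p - q) / (p + q)) ^ 2).
  { replace (k * rho0) with (4 * (p * q) * A0 / (p + q) ^ 2) by (rewrite HA; field; lra).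
    field. lra. }
  assert (Hpos : 0 < A0 * ((p - q) / (p + q)) ^ 2).
  { apply Rmult_lt_0_compat; [exact HA0|]. apply pow_lt, Rdiv_lt_0_compat; assumption. }
  split; [lra|].
  rewrite Hdef.
  replace (A0 / (A0 * ((p - q) / (p + q)) ^ 2)) with (((p + q) / (p - q)) ^ 2)
    by (field; repeat split; lra).
  apply sqrt_pow2. left. apply Rdiv_lt_0_compat; assumption.
Qed.

(** Both exponents give the same value because xi1 + xin = -1. *)
Lemma xi_quadratic x : x = xi1 \/ x = xin -> x ^ 2 + x = p * q / (p - q) ^ 2.
Proof. intros [-> | ->]; [exact xi1_quadratic|exact xin_quadratic]. Qed.

Lemma R0_correct E : kn * rho0 * tB ^ 2 * (E / (kn * rho0 * tB ^ 2)) = E.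
Proof.
  pose proof kn_pos. pose proof (pow_lt tB 2 HtB). field. repeat split; try lra.
  apply Rgt_not_eq, INR_n_pos.
Qed.

(** * Assembly of the four cases *)

Lemma blow_up_cases :
  ( J = 1%nat /\
    (forall xi, (xi = xi1 \/ xi = xin) -> xi ^ 2 + xi = 0) /\
    lim_left (fun t => (tB - t) * lam 1%nat t) tB (-1) /\
    (forall i, (2 <= i <= n)%nat ->
       bigO_left tB (lam i) (fun t => Rabs (ln (tB - t)))) /\
    bigO_left tB rho (fun t => 1 / (tB - t)) )
  \/
  ( J = 2%nat /\
    lim_left_pinfty (fun t => RInt (fun t => Rsum t) 0 t) tB /\
    (forall xi, (xi = xi1 \/ xi = xin) -> xi ^ 2 + xi = 0) /\
    (5 <= n)%nat /\
    lim_left (fun t => (tB - t) * lam 1%nat t) tB (-1) /\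
    (forall i, (3 <= i <= n)%nat ->
       lim_left (fun t => (tB - t) * lam i t) tB 0 /\
       lim_left_pinfty (Lam i) tB) /\
    littleo_left tB rho (fun t => 1 / (tB - t) ^ 2) )
  \/
  ( J = 2%nat /\ n = 4%nat /\
    (exists R0, 0 < R0 /\
       lim_left (fun t => exp (- RInt (fun t => Rsum t) 0 t)) tB R0 /\
       (forall xi, (xi = xi1 \/ xi = xin) ->
          xi ^ 2 + xi - k * rho0 * tB ^ 2 * R0 / 4 = 0)) /\
    (let A0 := (lam0 1%nat - lam0 3%nat) * (lam0 1%nat - lam0 4%nat) in
     k * rho0 < A0 /\
     lim_left (fun t => (tB - t) * lam 1%nat t) tB
       (- / 2 - / 2 * sqrt (A0 / (A0 - k * rho0))) /\
     (forall i, (i = 3 \/ i = 4)%nat ->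
        lim_left (fun t => (tB - t) * lam i t) tB
          (- / 2 + / 2 * sqrt (A0 / (A0 - k * rho0))))) /\
    bigO_left tB rho (fun t => 1 / (tB - t) ^ 2) )
  \/
  ( (3 <= J)%nat /\ (2 * J < n)%nat /\
    (exists R0, 0 < R0 /\
       lim_left (fun t => exp (- RInt (fun t => Rsum t) 0 t)) tB R0 /\
       (forall xi, (xi = xi1 \/ xi = xin) ->
          xi ^ 2 + xi - k * rho0 * tB ^ 2 * R0 / INR n = 0)) /\
    (exists C, 1 < C /\
       lim_left (fun t => (tB - t) * lam 1%nat t) tB (- C) /\
       (forall i, (J + 1 <= i <= n)%nat ->
          lim_left (fun t => (tB - t) * lam i t) tB (C - 1))) /\
    bigO_left tB rho (fun t => 1 / (tB - t) ^ 2) ).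
Proof.
  pose proof kn_pos as Hkn. pose proof J_lt_n as HJn.
  assert (Hxi1 : q = 0 -> xi1 = -1) by (intros ->; field; lra).
  assert (Hxin : q = 0 -> xin = 0) by (intros ->; field; lra).
  destruct criticality as [[Hg HE]|[Hg HE]]; rewrite xi1_quadratic in HE.
  - pose proof (quadratic_zero HE) as Hq0. pose proof (subcritical_J Hg Hq0) as HJ1.
    left. split; [exact HJ1|]. split; [|split; [|split]].
    + intros x Hx. rewrite (xi_quadratic x Hx). exact HE.
    + rewrite <- (Hxi1 Hq0). exact scaled_lam_1.
    + intros i Hi. apply subcritical_lam_bigO; assumption.
    + apply subcritical_rho_bigO; assumption.
  - right. destruct Hq as [Hqpos|Hq0].
    + right.
      assert (HEpos : 0 < p * q / (p - q) ^ 2).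
      { apply Rdiv_lt_0_compat; [apply Rmult_lt_0_compat; lra|apply pow_lt; lra]. }
      (* [R0] is the positive limit of theta divided by the constant that relates theta to the
         exponential of minus the integral of R. *)
      assert (HR0 : exists R0, 0 < R0 /\
        lim_left (fun t => exp (- RInt (fun t => Rsum t) 0 t)) tB R0 /\
        (forall xi, (xi = xi1 \/ xi = xin) -> xi ^ 2 + xi - k * rho0 * tB ^ 2 * R0 / INR n = 0)).
      { exists (p * q / (p - q) ^ 2 / (kn * rho0 * tB ^ 2)). split; [|split].
        - apply Rdiv_lt_0_compat; [exact HEpos|].
          apply Rmult_lt_0_compat; [|apply pow_lt, HtB]. apply Rmult_lt_0_compat; assumption.
        - apply exp_opp_RInt_Rsum_lim; assumption.
        - intros x Hx. rewrite (xi_quadratic x Hx).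
          set (E := p * q / (p - q) ^ 2).
          rewrite <- (R0_correct E) at 1. unfold Rdiv. ring. }
      pose proof (critical_identity Hg) as Hid.
      destruct (Nat.eq_dec J 2) as [HJ2|HJ2].
      * left.
        (* J = 2 annihilates one side of the identity, and q > 0 leaves n = 4. *)
        assert (Hn4 : n = 4%nat).
        { rewrite HJ2 in Hid. apply INR_eq. simpl in Hid |- *.
          assert (H : q * (INR n - 4) = 0) by lra. apply Rmult_integral in H. lra. }
        destruct (critical_J2_scaled_limits HJ2 Hn4 HE) as [HA Hsqrt].
        split; [exact HJ2|]. split; [exact Hn4|]. split; [|split].
        -- rewrite <- (INR_n_eq_4 Hn4). exact HR0.
        -- cbv zeta. rewrite Hsqrt. split; [exact HA|]. split.
           ++ replace (- / 2 - / 2 * ((p + q) / (p - q))) with xi1 by (field; lra).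
              exact scaled_lam_1.
           ++ intros i Hi.
              replace (- / 2 + / 2 * ((p + q) / (p - q))) with xin by (field; lra).
              apply scaled_lam_high. lia.
        -- apply (rho_bigO_inv_square _ HE).
      * right.
        assert (HJ3 : (3 <= J)%nat /\ (2 * J < n)%nat).
        { assert (HnJ : 1 <= INR n - INR J) by
            (rewrite <- INR_n_minus_J; apply (le_INR 1); lia).
          destruct (Nat.eq_dec J 1) as [HJ1|HJ1].
          (* The identity would read -p = q (n - 3), while n >= 2 gives q (n - 3) >= -q > -p. *)
          - exfalso. rewrite HJ1 in Hid, HnJ. simpl in Hid, HnJ.
            assert (H : 0 <= q * (INR n - 1 - 1)) by (apply Rmult_le_pos; lra). lra.
          - assert (HJ3 : (3 <= J)%nat) by lia. split; [exact HJ3|].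
            assert (H3 : 3 <= INR J) by (apply (le_INR 3) in HJ3; simpl in HJ3; lra).
            (* As J > 2, replacing p by the smaller q makes the identity a strict inequality, that
               is J < n - J. *)
            assert (Hlt : q * (INR J - 2) < q * (INR n - INR J - 2)).
            { rewrite <- Hid. apply Rmult_lt_compat_r; lra. }
            apply Rmult_lt_reg_l in Hlt; [|exact Hqpos].
            apply INR_lt. rewrite mult_INR. simpl (INR 2). lra. }
        destruct HJ3 as [HJ3 HnJ]. split; [exact HJ3|]. split; [exact HnJ|].
        split; [exact HR0|]. split; [|apply (rho_bigO_inv_square _ HE)].
        (* The witness is -xi1, which exceeds 1 as q > 0, and subtracting 1 from it gives xin. *)
        exists (p / (p - q)). split; [|split].
        -- apply Rmult_lt_reg_r with (p - q); [lra|]. unfold Rdiv.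
           rewrite Rmult_assoc, Rinv_l by lra. lra.
        -- replace (- (p / (p - q))) with xi1 by (field; lra). exact scaled_lam_1.
        -- intros i Hi. replace (p / (p - q) - 1) with xin by (field; lra).
           apply scaled_lam_high. lia.
    + symmetry in Hq0. left. rewrite (quadratic_at_zero Hq0) in HE.
      destruct (critical_degenerate Hq0 Hg HE) as [HJ2 [Hn5 Hinf]].
      split; [exact HJ2|]. split; [|split; [|split; [exact Hn5|split; [|split]]]].
      * apply lim_left_pinfty_of_exp_opp.
        pose proof (exp_opp_RInt_Rsum_lim 0 Hg HE) as H. 
        replace (0 / (kn * rho0 * tB ^ 2)) with 0 in H by (unfold Rdiv; ring). exact H.
      * intros x Hx. rewrite (xi_quadratic x Hx). apply quadratic_at_zero, Hq0.
      * rewrite <- (Hxi1 Hq0). exact scaled_lam_1.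
      * intros i Hi. split.
        -- rewrite <- (Hxin Hq0). apply scaled_lam_high. lia.
        -- apply lim_left_pinfty_ge with (2 := Hinf) (C := ln (beta i)).
           apply near_tB. intros t Ht. apply Lam_ge_Lam_n; [lia|exact Ht].
      * apply rho_littleo_inv_square, HE.
Qed.

(** At t = 0, where the Wronskian identity is not stated, the initial data decide. *)
Lemma lam_low_closed i t : (1 <= i <= J)%nat -> 0 <= t < tB -> lam i t = lam 1%nat t.
Proof.
  intros Hi Ht. destruct (Req_dec t 0) as [->|Ht0].
  - rewrite !lam_initial by lia. apply Hlow, Hi.
  - apply lam_low; [exact Hi|lra].
Qed.

End Solution.

Lemma step_low J a b i : (i <= J)%nat -> step J a b i = a.
Proof. intros H. unfold step. destruct (le_lt_dec i J); [reflexivity|lia]. Qed.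

Lemma step_high J a b i : (J < i)%nat -> step J a b i = b.
Proof. intros H. unfold step. destruct (le_lt_dec i J); [lia|reflexivity]. Qed.

Theorem theorem4p2
  (n : nat) (k cb rho0 : R) (J : nat) (lam0 : nat -> R)
  (lam : nat -> R -> R) (rho : R -> R) (tB p q : R) :
  (2 <= n)%nat -> 0 < k -> 0 < cb -> 0 < rho0 ->
  (1 <= J <= n)%nat ->
  (forall i, (1 <= i <= J)%nat -> lam0 i = lam0 1%nat) ->
  ((J < n)%nat -> lam0 J < lam0 (S J)) ->
  (forall i, (J + 1 <= i < n)%nat -> lam0 i <= lam0 (S i)) ->
  0 < tB ->
  is_maximal_sol n k cb rho0 lam0 tB lam rho ->
  (* u_i(t) = exp (int_0^t lam_i) ; lim u_1' u_n = -p, lim u_1 u_n' = q *)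
  lim_left (fun t => Derive (fun s => exp (RInt (lam 1%nat) 0 s)) t
                     * exp (RInt (lam n) 0 t)) tB (- p) ->
  lim_left (fun t => exp (RInt (lam 1%nat) 0 t)
                     * Derive (fun s => exp (RInt (lam n) 0 s)) t) tB q ->
  0 <= q -> q < p ->
  let xi1 := - p / (p - q) in
  let xin := q / (p - q) in
  let gamma := (- p * INR J + q * INR (n - J)) / (p - q) in
  exists Rf : nat -> R -> R,
    let Rsum := fun t => sum_n_m (fun i => Rf i t) 1 n in
    (forall i, (1 <= i <= n)%nat -> lim_left (fun t => (tB - t) * Rf i t) tB 0) /\
    (forall i t, (1 <= i <= J)%nat -> 0 <= t < tB -> Rf i t = Rf 1%nat t) /\
    (forall i t, (1 <= i <= J)%nat -> 0 <= t < tB ->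
        lam i t = xi1 / (tB - t) + Rf i t) /\
    (forall i t, (J < i <= n)%nat -> 0 <= t < tB ->
        lam i t = xin / (tB - t) + Rf i t) /\
    (forall t, 0 <= t < tB ->
        sum_n_m (fun i => lam i t) 1 n = gamma / (tB - t) + Rsum t) /\
    ( (* case (1) *)
      ( J = 1%nat /\
        (forall xi, (xi = xi1 \/ xi = xin) -> xi ^ 2 + xi = 0) /\
        lim_left (fun t => (tB - t) * lam 1%nat t) tB (-1) /\
        (forall i, (2 <= i <= n)%nat ->
           bigO_left tB (lam i) (fun t => Rabs (ln (tB - t)))) /\
        bigO_left tB rho (fun t => 1 / (tB - t)) )
    \/ (* case (2-a) *)
      ( J = 2%nat /\
        lim_left_pinfty (fun t => RInt Rsum 0 t) tB /\
        (forall xi, (xi = xi1 \/ xi = xin) -> xi ^ 2 + xi = 0) /\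
        (5 <= n)%nat /\
        lim_left (fun t => (tB - t) * lam 1%nat t) tB (-1) /\
        (forall i, (3 <= i <= n)%nat ->
           lim_left (fun t => (tB - t) * lam i t) tB 0 /\
           lim_left_pinfty (fun t => RInt (lam i) 0 t) tB) /\
        littleo_left tB rho (fun t => 1 / (tB - t) ^ 2) )
    \/ (* case (2-b) *)
      ( J = 2%nat /\ n = 4%nat /\
        (exists R0, 0 < R0 /\
           lim_left (fun t => exp (- RInt Rsum 0 t)) tB R0 /\
           (forall xi, (xi = xi1 \/ xi = xin) ->
              xi ^ 2 + xi - k * rho0 * tB ^ 2 * R0 / 4 = 0)) /\
        (let A0 := (lam0 1%nat - lam0 3%nat) * (lam0 1%nat - lam0 4%nat) in
         k * rho0 < A0 /\
         lim_left (fun t => (tB - t) * lam 1%nat t) tB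
           (- / 2 - / 2 * sqrt (A0 / (A0 - k * rho0))) /\
         (forall i, (i = 3 \/ i = 4)%nat ->
            lim_left (fun t => (tB - t) * lam i t) tB
              (- / 2 + / 2 * sqrt (A0 / (A0 - k * rho0))))) /\
        bigO_left tB rho (fun t => 1 / (tB - t) ^ 2) )
    \/ (* case (3) *)
      ( (3 <= J)%nat /\ (2 * J < n)%nat /\
        (exists R0, 0 < R0 /\
           lim_left (fun t => exp (- RInt Rsum 0 t)) tB R0 /\
           (forall xi, (xi = xi1 \/ xi = xin) ->
              xi ^ 2 + xi - k * rho0 * tB ^ 2 * R0 / INR n = 0)) /\
        (exists C, 1 < C /\
           lim_left (fun t => (tB - t) * lam 1%nat t) tB (- C) /\
           (forall i, (J + 1 <= i <= n)%nat ->
              lim_left (fun t => (tB - t) * lam i t) tB (C - 1))) /\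
        bigO_left tB rho (fun t => 1 / (tB - t) ^ 2) ) ).
Proof.
  intros Hn Hk Hcb Hrho0 HJ Hlow Hstep Hmono HtB Hmax Hlim1 Hlimn Hq Hpq xi1 xin gamma.
  pose proof (proj1 Hmax) as Hsol.
  assert (Hincr : forall i j, (J + 1 <= i <= j)%nat -> (j <= n)%nat -> lam0 i <= lam0 j).
  { intros i j Hij. induction j as [|j IH]; intros Hj; [lia|].
    destruct (Nat.eq_dec i (S j)) as [->|Hne]; [apply Rle_refl|].
    apply Rle_trans with (lam0 j); [apply IH; lia|apply Hmono; lia]. }
  assert (Hhigh : forall i, (J < i <= n)%nat -> lam0 1%nat < lam0 i <= lam0 n).
  { intros i Hi. split; [|apply Hincr; lia].
    rewrite <- (Hlow J) by lia.
    apply Rlt_le_trans with (lam0 (S J)); [apply Hstep; lia|apply Hincr; lia]. }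
  (* Replaces u_i' by u_i lambda_i, so that both limits concern the product u_1 u_n times a single
     lambda. *)
  assert (Hderive : forall i t, (1 <= i <= n)%nat -> 0 < t < tB ->
    Derive (fun s => exp (RInt (lam i) 0 s)) t = exp (RInt (lam i) 0 t) * lam i t).
  { intros i t Hi Ht. apply is_derive_unique.
    pose proof (Lam_derive n k cb rho0 lam0 tB lam rho HtB Hsol i t Hi Ht) as D.
    rewrite Rmult_comm. exact (is_derive_comp exp _ t _ _ (is_derive_exp _) D). }
  assert (H1 : lim_left (fun t => exp (primitive lam 1 t + primitive lam n t) * lam 1%nat t) tB (- p)).
  { apply lim_left_ext with (2 := Hlim1). apply near_tB; [exact HtB|]. intros t Ht.
    rewrite Hderive by (lia || exact Ht). rewrite exp_plus. unfold primitive. ring. }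
  assert (H2 : lim_left (fun t => exp (primitive lam 1 t + primitive lam n t) * lam n t) tB q).
  { apply lim_left_ext with (2 := Hlimn). apply near_tB; [exact HtB|]. intros t Ht.
    rewrite Hderive by (lia || exact Ht). rewrite exp_plus. unfold primitive. ring. }
  exists (fun i t => lam i t - step J xi1 xin i / (tB - t)). intros Rsum.
  split; [|split; [|split; [|split; [|split]]]].
  - intros i Hi. eapply scaled_Rf; eassumption.
  - intros i t Hi Ht. rewrite !step_low by lia. f_equal.
    eapply lam_low_closed; eassumption.
  - intros i t Hi Ht. rewrite step_low by lia. ring.
  - intros i t Hi Ht. rewrite step_high by lia. ring.
  - intros t Ht. eapply sum_lam_decomposition; eassumption.
  - eapply blow_up_cases; eassumption.
Qed.
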